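(* Let $R$ be a simple (irreducible, possibly non-reduced) root system with a choice of positive roots $R^+$, weight lattice $P$ and root lattice $Q\subseteq P$. Then a lattice $L\subset P$ is quadratic only in the following cases: i) $R$ is of type $\mathsf A_1$ and $L=P$ or $L=Q$; ii) $R$ is of type $\mathsf{BC}_1$ and $L=P$; iii) $R$ is of type $\mathsf A_\ell$, $\mathsf C_\ell$ or $\mathsf{BC}_\ell$ with $\ell\ge2$ and $L=P$; iv) $R$ is of type $\mathsf B_\ell$ with $\ell\ge2$ and $L=Q$.
   Context: $P=\{\lambda:\langle\lambda,\alpha^\vee\rangle\in\mathbb Z\ \forall\alpha\in R\}$, $P^+$ is the monoid of dominant weights, $Q$ is the lattice generated by $R$. For a sublattice $L\subseteq P$ put $L^+=L\cap P^+$. $L$ is *admissible* if $L\supset Q$ and $L^+$ is a finitely generated free commutative monoid; its unique basis $\mathcal B$ (also a basis of $L$) is called the admissible basis of $L$. For $\lambda=\sum_{\varepsilon\in\mathcal B}a_\varepsilon\varepsilon\in L$ put $hgt_{\mathcal B}(\lambda)=\sum_{\varepsilon\in\mathcal B} a_\varepsilon$. An admissible lattice $L$ is *quadratic* if whenever $\lambda\in L^+$ satisfies $\lambda\le\varepsilon+\eta$ for some $\varepsilon,\eta\in\mathcal B$ (dominant order: $\mu\le\lambda$ iff $\lambda-\mu\in\mathbb N[R^+]$), then $hgt_{\mathcal B}(\lambda)\le2$. Note that $\mathsf B_2$ and $\mathsf C_2$ denote the same root system (with different numberings), so both iii) and iv) apply to it. *)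

(* Defs.v *)
From mathcomp Require Import all_boot all_order all_algebra.
From mathcomp Require Import finmap.
From mathcomp Require Import boolp classical_sets.

Set Implicit Arguments.
Unset Strict Implicit.
Unset Printing Implicit Defensive.

Import GRing.Theory Num.Theory.

Local Open Scope classical_set_scope.
Local Open Scope ring_scope.

Section RootSystem.

(* [form] is the inner product of the Euclidean space V; nothing below needs
   the field of scalars to be complete, so it is any real field. *)
Variables (K : realFieldType) (V : vectType K) (form : {dot V for idfun}).

(* <l, a^vee>, for the coroot a^vee of a. *)
Definition pairing (l a : V) : K := 2 * form l a / form a a.

Definition is_integer (x : K) : Prop := exists z : int, x = z%:~R.

(* R is not assumed to be reduced. *)
Record root_system (R : {fset V}) : Prop := RootSystem {
  root_neq0 : 0 \notin R;
  root_span : <<R>>%VS = fullv;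
  root_refl : forall a b, a \in R -> b \in R -> b - pairing b a *: a \in R;
  root_int : forall a b, a \in R -> b \in R -> is_integer (pairing b a)
}.

Definition irreducible_roots (R : {fset V}) : Prop :=
  R <> fset0 /\
  forall S T : {fset V}, R = (S `|` T)%fset ->
    (forall s t, s \in S -> t \in T -> form s t = 0) ->
    S = fset0 \/ T = fset0.

(* In [pos_closed], a and b may be equal: if a is positive and 2a is a root
   then 2a is positive. *)
Record positive_roots (R Rp : {fset V}) : Prop := PositiveRoots {
  pos_root : {subset Rp <= R};
  pos_opp : forall a, a \in R -> (- a \in Rp) = (a \notin Rp);
  pos_closed : forall a b, a \in Rp -> b \in Rp -> a + b \in R -> a + b \in Rp
}.

Definition weight_lattice (R : {fset V}) : set V :=
  [set l | forall a, a \in R -> is_integer (pairing l a)].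

Definition root_lattice (R : {fset V}) : set V :=
  [set x | exists c : V -> int, x = \sum_(a <- R) a *~ c a].

Definition dominant_weights (R Rp : {fset V}) : set V :=
  [set l | weight_lattice R l /\ forall a, a \in Rp -> 0 <= pairing l a].

(* The dominant order: m <= l iff l - m is in N[R^+]. *)
Definition dominant_le (Rp : {fset V}) (m l : V) : Prop :=
  exists c : V -> nat, l - m = \sum_(a <- Rp) a *+ c a.

Definition sublattice (L P : set V) : Prop :=
  [/\ L `<=` P, L 0 & forall x y, L x -> L y -> L (x - y)].

(* L^+ *)
Definition dominant_part (R Rp : {fset V}) (L : set V) : set V :=
  L `&` dominant_weights R Rp.

(* M is a free commutative monoid with basis the finite set B: the map [comb]
   from N^B to V is injective, with image M. *)
Definition monoid_basis (M : set V) (B : {fset V}) : Prop :=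
  let comb (c : {ffun B -> nat}) := \sum_(e : B) val e *+ c e in
  injective comb /\ range comb = M.

Definition admissible (R Rp : {fset V}) (L : set V) : Prop :=
  [/\ sublattice L (weight_lattice R),
      root_lattice R `<=` L
    & exists B, monoid_basis (dominant_part R Rp L) B].

(* When B is the admissible basis of L and l is in L, l has exactly one family
   of coordinates; the default value 0 of [xget] is not used. *)
Definition hgt (B : {fset V}) (l : V) : int :=
  let a := xget (0 : {ffun B -> int})
                [set a | l = \sum_(e : B) val e *~ a e] in
  \sum_(e : B) a e.

Definition quadratic (R Rp : {fset V}) (L : set V) : Prop :=
  admissible R Rp L /\
  forall B, monoid_basis (dominant_part R Rp L) B ->
  forall l e h, dominant_part R Rp L l -> e \in B -> h \in B ->
    dominant_le Rp l (e + h) -> hgt B l <= 2.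

(* R is isomorphic to the root system M of the subspace of K^n that M spans:
   since R spans V, an injective linear map sending R onto M is a linear
   isomorphism of V with the span of M. *)
Definition isomorphic_to (R : {fset V}) n (M : set 'rV[K]_n) : Prop :=
  exists2 f : 'Hom(V, 'rV[K]_n), injective f & f @` [set` R] = M.

End RootSystem.

Section Models.

Variables (K : realFieldType) (n : nat).

Let e (i : 'I_n) : 'rV[K]_n := delta_mx 0 i.

Definition differences : set 'rV[K]_n :=
  [set x | exists i j, i != j /\ x = e i - e j].

(* the vectors +/- e_i +/- e_j with i != j; the booleans are signs *)
Definition sums_and_differences : set 'rV[K]_n :=
  [set x | exists i j (s t : bool),
     i != j /\ x = (-1) ^+ s *: e i + (-1) ^+ t *: e j].

(* the vectors +/- k e_i *)
Definition axis_vectors (k : K) : set 'rV[K]_n :=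
  [set x | exists i (s : bool), x = ((-1) ^+ s * k) *: e i].

Definition rootsB : set 'rV[K]_n := sums_and_differences `|` axis_vectors 1.
Definition rootsC : set 'rV[K]_n := sums_and_differences `|` axis_vectors 2.
Definition rootsBC : set 'rV[K]_n := rootsB `|` rootsC.

End Models.

(* l is the rank; the roots of type A_l lie in a hyperplane of K^(l+1). *)
Section Types.

Variables (K : realFieldType) (V : vectType K) (R : {fset V}) (l : nat).

Definition of_type_A : Prop := isomorphic_to R (@differences K l.+1).
Definition of_type_B : Prop := isomorphic_to R (@rootsB K l).
Definition of_type_C : Prop := isomorphic_to R (@rootsC K l).
Definition of_type_BC : Prop := isomorphic_to R (@rootsBC K l).

End Types.

(* Main.v *)
(* Let a_1, ..., a_n be the simple roots.  An admissible lattice L is spanned by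
   multiples c_i of the fundamental weights, with c_i = 1 or 2 because L contains
   the roots, and its height is the functional h = sum_i <., a_i^vee> / c_i.
   L is quadratic iff h(a_j) >= 0 for all j.  If so, h is monotone for the
   dominant order; if h(a_j) < 0, the weight 2 c_j w_j - a_j is dominant and has
   height 2 - h(a_j) > 2.
   In terms of the Cartan matrix h(a_j) >= 0 bounds the column sums, and h <> 0
   makes one of them positive.  That column is an end of the Dynkin diagram, and
   walking from there the column bounds force the diagram to be a path with
   simple bonds except possibly the last one: the types A, B, C, BC.
   Conversely, in the standard coordinates of these types h is x_1, or
   x_1 - x_(l+1) for type A (halved when L = Q in type A_1), which is nonnegative
   on the simple roots. *)

(* The bound [c_i <= 2] comes from [<a_i, a_i^vee> = 2]: the multiplier divides the value of the
   coroot on every element of [L], and [a_i] lies in [L]. If [2 a_i] is a root, [c_i = 2] is forced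
   and costs no weights; otherwise it is a genuine choice. The lattices [L = Q] in types [B] and
   [A_1] come from that choice at the last vertex. Two obstacles shape the rest. A positive system
   is given only as a set of roots closed under addition, so no separating functional is available;
   pairing with the sum of the positive roots provides one, and both the simple roots and induction
   along reflections are derived from it. An isomorphism with a model is only linear and is not
   known to respect the inner products. What it transports is the set of roots, and a coroot is
   recovered from this set as the only functional, of value 2 at its root, whose reflection
   preserves the roots. In the converse the positive system of the model is arbitrary. It is made
   standard by a signed permutation of the coordinates, read off from the signs of the roots
   themselves. *)
From HB Require Import structures.
Require Import Defs.
From mathcomp Require Import all_boot all_order all_fingroup all_algebra.
From mathcomp Require Import finmap.
From mathcomp Require Import boolp classical_sets.
From mathcomp Require Import ring lra zify.

Set Implicit Arguments.
Unset Strict Implicit.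
Unset Printing Implicit Defensive.

Import Order.TTheory GRing.Theory Num.Theory.

Local Open Scope ring_scope.

(** * Root systems *)

Section Integers.

Variable K : realFieldType.
Implicit Types x y : K.

Lemma is_integer0 : is_integer (0 : K).
Proof. by exists 0. Qed.

Lemma is_integerD x y : is_integer x -> is_integer y -> is_integer (x + y).
Proof. by move=> [a ->] [b ->]; exists (a + b); rewrite rmorphD. Qed.

Lemma is_integerN x : is_integer x -> is_integer (- x).
Proof. by move=> [a ->]; exists (- a); rewrite rmorphN. Qed.

Lemma is_integerB x y : is_integer x -> is_integer y -> is_integer (x - y).
Proof. by move=> hx hy; apply/is_integerD => //; apply/is_integerN. Qed.

Lemma is_integerM x y : is_integer x -> is_integer y -> is_integer (x * y).
Proof. by move=> [a ->] [b ->]; exists (a * b); rewrite rmorphM. Qed.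

Lemma is_integer_nat (m : nat) : is_integer (m%:R : K).
Proof. by exists m%:Z. Qed.

Lemma is_integer_sum I (r : seq I) (F : I -> K) :
  (forall i, is_integer (F i)) -> is_integer (\sum_(i <- r) F i).
Proof.
move=> h; elim: r => [|i r ih]; first by rewrite big_nil; apply: is_integer0.
by rewrite big_cons; apply: is_integerD.
Qed.

Lemma is_integer_gt0 x : is_integer x -> 0 < x -> 1 <= x.
Proof. by move=> [a ->]; rewrite ltr0z ler1z. Qed.

Lemma is_integer_ge0_nat x : is_integer x -> 0 <= x -> exists m : nat, x = m%:R.
Proof. by move=> [[m|m] ->]; rewrite ?ler0z // => _; exists m. Qed.

Lemma is_integer_gt1 x : is_integer x -> 1 < x -> 2 <= x.
Proof.
by move=> [a ->]; rewrite -[1]/(1%:~R) -[2]/(2%:~R) ltr_int ler_int; lia.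
Qed.

Lemma not_integer_half : ~ is_integer (2^-1 : K).
Proof.
move=> h; have : (1 : K) <= 2^-1 by apply: is_integer_gt0; rewrite ?invr_gt0.
by lra.
Qed.

End Integers.

Section Pairing.

Variables (K : realFieldType) (V : vectType K) (form : {dot V for idfun}).
Local Notation pairing := (pairing form).

Lemma form_sym u v : form u v = form v u.
Proof. by rewrite hermC expr0 mul1r. Qed.

Lemma form_gt0 u : u != 0 -> 0 < form u u.
Proof. exact: neq0_dnorm_gt0. Qed.

Lemma formDl u v w : form (u + v) w = form u w + form v w.
Proof. exact: linearDl. Qed.

Lemma formZl k u w : form (k *: u) w = k * form u w.
Proof. exact: linearZl_LR. Qed.

Lemma formDr u v w : form w (u + v) = form w u + form w v.
Proof. by rewrite form_sym formDl !(form_sym w). Qed.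

Lemma formZr k u w : form w (k *: u) = k * form w u.
Proof. by rewrite form_sym formZl (form_sym w). Qed.

Lemma formNl u w : form (- u) w = - form u w.
Proof. by rewrite -scaleN1r formZl mulN1r. Qed.

Lemma formNr u w : form w (- u) = - form w u.
Proof. by rewrite -scaleN1r formZr mulN1r. Qed.

Lemma form0l w : form 0 w = 0.
Proof. by rewrite -(scale0r (0 : V)) formZl mul0r. Qed.

Lemma form_suml I (r : seq I) (P : pred I) (F : I -> V) w :
  form (\sum_(i <- r | P i) F i) w = \sum_(i <- r | P i) form (F i) w.
Proof. exact: (big_morph _ (fun u v => formDl u v w) (form0l w)). Qed.

Lemma form_sumr I (r : seq I) (P : pred I) (F : I -> V) w :
  form w (\sum_(i <- r | P i) F i) = \sum_(i <- r | P i) form w (F i).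
Proof.
by rewrite form_sym form_suml; apply: eq_bigr => i _; apply: form_sym.
Qed.

Lemma pairingDl u v a : pairing (u + v) a = pairing u a + pairing v a.
Proof. by rewrite /Defs.pairing formDl mulrDr mulrDl. Qed.

Lemma pairingZl k u a : pairing (k *: u) a = k * pairing u a.
Proof. by rewrite /Defs.pairing formZl mulrCA -!mulrA. Qed.

Lemma pairingNl u a : pairing (- u) a = - pairing u a.
Proof. by rewrite -scaleN1r pairingZl mulN1r. Qed.

Lemma pairingBl u v a : pairing (u - v) a = pairing u a - pairing v a.
Proof. by rewrite pairingDl pairingNl. Qed.

Lemma pairing0l a : pairing 0 a = 0.
Proof. by rewrite -(scale0r (0 : V)) pairingZl mul0r. Qed.

Lemma pairingMnl u m a : pairing (u *+ m) a = pairing u a * m%:R.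
Proof. by rewrite -scaler_nat pairingZl mulrC. Qed.

Lemma pairing_suml I (r : seq I) (P : pred I) (F : I -> V) a :
  pairing (\sum_(i <- r | P i) F i) a = \sum_(i <- r | P i) pairing (F i) a.
Proof. exact: (big_morph _ (fun u v => pairingDl u v a) (pairing0l a)). Qed.

Lemma pairingNr u a : pairing u (- a) = - pairing u a.
Proof.
by rewrite /Defs.pairing !formNr formNl opprK mulrN mulNr.
Qed.

Lemma pairingZr k u a : pairing u (k *: a) = k^-1 * pairing u a.
Proof.
rewrite /Defs.pairing !formZr formZl.
have [->|k0] := eqVneq k 0; first by rewrite !(mul0r, mulr0, invr0).
have [->|f0] := eqVneq (form a a) 0; first by rewrite !(mulr0, invr0).
by field; rewrite k0 f0.
Qed.

Lemma pairing_self a : a != 0 -> pairing a a = 2.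
Proof. by move/form_gt0/lt0r_neq0 => h; rewrite /Defs.pairing mulfK. Qed.

Lemma pairing_gt0 u a : a != 0 -> (0 < pairing u a) = (0 < form u a).
Proof.
by move=> /form_gt0 h; rewrite /Defs.pairing pmulr_lgt0 ?invr_gt0 // pmulr_rgt0.
Qed.

Lemma pairing_lt0 u a : a != 0 -> (pairing u a < 0) = (form u a < 0).
Proof.
by move=> /form_gt0 h; rewrite /Defs.pairing pmulr_llt0 ?invr_gt0 // pmulr_rlt0.
Qed.

Lemma pairing_eq0 u a : a != 0 -> (pairing u a == 0) = (form u a == 0).
Proof.
move=> /form_gt0/lt0r_neq0 h.
by rewrite /Defs.pairing !mulf_eq0 invr_eq0 (negPf h) pnatr_eq0 /= orbF.
Qed.

End Pairing.

Section Roots.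

Variables (K : realFieldType) (V : vectType K) (form : {dot V for idfun}).
Variables (R Rp : {fset V}).
Hypothesis hR : root_system form R.
Local Notation pairing := (pairing form).

Lemma root_nz a : a \in R -> a != 0.
Proof. by apply: contraTneq => ->; apply: root_neq0 hR. Qed.

Lemma root_opp a : a \in R -> - a \in R.
Proof.
move=> aR; have := root_refl hR aR aR.
rewrite (pairing_self form (root_nz aR)).
by rewrite scaler_nat mulr2n opprD addrA subrr add0r.
Qed.

(** Both pairings are positive integers. If both were at least 2, then [form a b] would bound both
    squared norms from above, and [a - b] would have nonpositive squared norm. So one pairing is 1,
    and the corresponding reflection yields [a - b] or [b - a]. *)
Lemma root_sub a b : a \in R -> b \in R -> 0 < form a b -> a != b -> a - b \in R.
Proof.
move=> aR bR ab0 neq.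
have [a0 b0] := (root_nz aR, root_nz bR).
have hp := root_int hR bR aR; have hq := root_int hR aR bR.
have p1 : 1 <= pairing a b by apply: is_integer_gt0; rewrite ?pairing_gt0.
have q1 : 1 <= pairing b a
  by apply: is_integer_gt0; rewrite ?pairing_gt0 // form_sym.
have [p2|p2] := ltP 1 (pairing a b); last first.
  have e : pairing a b = 1 by apply/le_anti/andP.
  by have := root_refl hR bR aR; rewrite e scale1r.
have [q2|q2] := ltP 1 (pairing b a); last first.
  have e : pairing b a = 1 by apply/le_anti/andP.
  by have /root_opp := root_refl hR aR bR; rewrite e scale1r opprB.
have := is_integer_gt1 hp p2; have := is_integer_gt1 hq q2.
rewrite /Defs.pairing !ler_pdivlMr ?form_gt0 // (form_sym form b a) => h1 h2.
have : 0 < form (a - b) (a - b) by rewrite form_gt0 // subr_eq0.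
rewrite formDl !formDr !formNl !formNr (form_sym form b a) => h3.
by exfalso; lra.
Qed.

Lemma root_add a b : a \in R -> b \in R -> form a b < 0 -> a != - b -> a + b \in R.
Proof.
move=> aR bR ab neq; rewrite -[b]opprK; apply: root_sub => //.
- exact: root_opp.
- by rewrite formNr oppr_gt0.
Qed.

(* The difference of [phi] and the coroot of [a] kills [a], so composing the two
   reflections translates [b] by multiples of [a]; finiteness of [R] forces the
   translation to vanish. *)
Lemma pairing_unique (phi : V -> K) a :
  (forall k u v, phi (k *: u + v) = k * phi u + phi v) ->
  a \in R -> phi a = 2 -> (forall b, b \in R -> b - phi b *: a \in R) ->
  forall v, phi v = pairing v a.
Proof.
move=> lin aR phia stab.
have a0 := root_nz aR.
have phiD u v : phi (u + v) = phi u + phi v by have := lin 1 u v; rewrite scale1r mul1r.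
have phi0 : phi 0 = 0 by apply/(addrI (phi 0)); rewrite -phiD !addr0.
have phiZ k u : phi (k *: u) = k * phi u by have := lin k u 0; rewrite phi0 !addr0.
have onR b : b \in R -> phi b = pairing b a.
  move=> bR; apply/eqP; rewrite -subr_eq0; apply/negP => /negP d0.
  set d := phi b - pairing b a in d0.
  have step (m : nat) : b + (m%:R * d) *: a \in R.
    elim: m => [|m ih]; first by rewrite mul0r scale0r addr0.
    have := root_refl hR aR (stab _ ih).
    rewrite phiD phiZ phia pairingBl pairingDl !pairingZl pairing_self //.
    rewrite -natr1 -!scaleNr -!addrA -!scalerDl.
    by congr (_ + _ *: _ \in R); rewrite /d; ring.
  pose g (i : 'I_(#|` R|).+1) : V := b + ((i : nat)%:R * d) *: a.
  have ginj : injective g.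
    move=> i j /addrI /eqP; rewrite -subr_eq0 -scalerBl scaler_eq0 (negPf a0) orbF.
    rewrite -mulrBl mulf_eq0 (negPf d0) orbF subr_eq0 eqr_nat.
    by move/eqP/ord_inj.
  have : (#|` [fset g i | i in 'I_(#|` R|).+1]%fset| <= #|` R|)%N.
    by apply: fsubset_leq_card; apply/fsubsetP => x /imfsetP [i _ ->]; apply: step.
  by rewrite card_imfset //= -cardE card_ord ltnn.
move=> v.
have /coord_span -> : v \in <<in_tuple (enum_fset R)>>%VS.
  by rewrite (root_span hR) memvf.
rewrite pairing_suml (big_morph phi phiD phi0); apply: eq_bigr => i _.
by rewrite phiZ pairingZl onR // mem_nth.
Qed.

End Roots.

(** * Positive systems and bases *)

Section Reflections.

Variables (K : realFieldType) (V : vectType K) (form : {dot V for idfun}).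
Local Notation pairing := (pairing form).

Definition reflection (a v : V) : V := v - pairing v a *: a.
Local Notation refl := reflection.

Lemma reflK a : a != 0 -> involutive (refl a).
Proof.
move=> a0 v; rewrite /reflection pairingBl pairingZl pairing_self //.
rewrite -!scaleNr -addrA -scalerDl.
by rewrite [X in X *: _](_ : _ = 0) ?scale0r ?addr0 //; ring.
Qed.

Lemma refl_self a : a != 0 -> refl a a = - a.
Proof.
by move=> a0; rewrite /reflection pairing_self // scaler_nat mulr2n opprD addrA subrr add0r.
Qed.

Lemma form_refl a u v : a != 0 -> form (refl a u) (refl a v) = form u v.
Proof.
move=> /(form_gt0 form)/lt0r_neq0 fa.
rewrite /reflection formDl !formDr !formNl !formNr !formZl !formZr (form_sym form a v).
by rewrite /Defs.pairing; field.
Qed.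

Lemma pairing_refl a u v :
  a != 0 -> pairing (refl a u) v = pairing u (refl a v).
Proof.
by move=> a0; rewrite /Defs.pairing -(form_refl _ _ a0) reflK // -(form_refl v v a0).
Qed.

End Reflections.

Section PositiveSystems.

Variables (K : realFieldType) (V : vectType K) (form : {dot V for idfun}).
Variables (R Rp : {fset V}).
Hypotheses (hR : root_system form R) (hP : positive_roots R Rp).
Local Notation pairing := (pairing form).
Local Notation refl := (reflection form).

Lemma root_of_pos a : a \in Rp -> a \in R.
Proof. exact: pos_root hP a. Qed.

Lemma pos_neq0 a : a \in Rp -> a != 0.
Proof. by move/root_of_pos/(root_nz hR). Qed.

Lemma refl_root a b : a \in R -> b \in R -> refl a b \in R.
Proof. exact: root_refl. Qed.

Lemma pos_or_opp a : a \in R -> a \in Rp \/ - a \in Rp.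
Proof. by move=> /(pos_opp hP) ->; case: (a \in Rp); [left | right]. Qed.

(** If the sum vanishes, its first term [a] has negative product with the sum of the others, hence
    with some [b] among them. Then [a + b] is again a positive root, and replacing the two by it
    gives a shorter vanishing sum. *)
Lemma sum_pos_neq0 (s : seq V) :
  s != [::] -> all (mem Rp) s -> \sum_(b <- s) b != 0.
Proof.
have [k] := ubnP (size s); elim: k s => // k ih [|a s] //= sk _ /andP [ap sp].
apply/negP => /eqP s0.
have aR := root_of_pos ap.
have : \sum_(b <- s) form a b < 0.
  move: (congr1 (form a) s0); rewrite big_cons formDr form_sumr -(scale0r (0 : V)).
  rewrite formZr mul0r => /eqP; rewrite addrC addr_eq0 => /eqP ->.
  by rewrite oppr_lt0 form_gt0 // pos_neq0.
case: (boolP (has (fun b => form a b < 0) s)) => [/hasP [b bs ab] _|]; last first.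
  rewrite -all_predC => /allP h; rewrite ltNge big_seq sumr_ge0 // => b /h /=.
  by rewrite -leNgt.
have bp : b \in Rp := allP sp b bs.
have abp : a + b \in Rp.
  have bR := root_of_pos bp.
  apply: (pos_closed hP) => //; apply: (root_add hR aR bR ab).
  by apply: contraTneq ap => ->; rewrite (pos_opp hP bR) negbK.
suff /negP : \sum_(c <- a + b :: rem b s) c != 0.
  by apply; apply/eqP; rewrite -[RHS]s0 !big_cons -addrA [in RHS](big_rem b).
apply: ih => //=.
- have : (0 < size s)%N by case: (s) bs.
  by rewrite size_rem // => /prednK ->.
- by rewrite abp; apply/allP => c /mem_rem /(allP sp).
Qed.

(** Twice the Weyl vector, with multiples of a root counted separately in the non-reduced case. *)
Definition rho2 : V := \sum_(b <- Rp) b.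

(** Otherwise the reflected root is [b + k a] with [k] a natural number, and [b], its opposite and
    [k] copies of [a] are positive roots with sum zero. *)
Lemma pairing_refl_npos a b :
  a \in Rp -> b \in Rp -> refl a b \notin Rp -> 0 < pairing b a.
Proof.
move=> ap bp rn; rewrite ltNge; apply/negP => le0.
have [aR bR] := (root_of_pos ap, root_of_pos bp).
have [||k kE] := @is_integer_ge0_nat K (- pairing b a).
- exact/is_integerN/(root_int hR).
- by rewrite oppr_ge0.
have nr : - refl a b \in Rp by rewrite (pos_opp hP) // refl_root.
have all_pos : all (mem Rp) (b :: - refl a b :: nseq k a).
  by rewrite /= bp nr; apply/allP => c /nseqP [->].
have /eqP := sum_pos_neq0 (isT : b :: _ != [::]) all_pos; apply.
rewrite !big_cons big_nseq iter_addr_0 /reflection -scaler_nat -kE scaleNr opprB.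
by rewrite addrC addrAC subrK subrr.
Qed.

(** Here [a] need not be simple. The positive roots that stay positive under its reflection are
    permuted by it and cancel; each of the others pairs positively with [a], and [a] is one of
    them. *)
Lemma rho2_gt0 a : a \in Rp -> 0 < form rho2 a.
Proof.
move=> ap; have aR := root_of_pos ap; have a0 := pos_neq0 ap.
rewrite -(pairing_gt0 form _ a0) /rho2 pairing_suml.
rewrite (bigID (fun b => refl a b \in Rp)) /=.
set S := \sum_(b <- _ | _) _.
have -> : S = 0.
  (* Reindexing by the reflection changes the sign of every pairing with [a]. *)
  have SN : S = - S.
    rewrite {1}/S -big_filter.
    have pe : perm_eq [seq b <- Rp | refl a b \in Rp]
       [seq refl a b | b <- [seq b <- Rp | refl a b \in Rp]].
      apply: uniq_perm; first exact/filter_uniq/fset_uniq.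
        rewrite (map_inj_uniq (inv_inj (reflK form a0))).
        exact/filter_uniq/fset_uniq.
      move=> b; rewrite mem_filter; apply/andP/mapP.
        move=> [h1 h2]; exists (refl a b); last by rewrite reflK.
        by rewrite mem_filter reflK // h2 h1.
      by move=> [c]; rewrite mem_filter => /andP [h1 h2] ->; rewrite reflK.
    rewrite (perm_big _ pe) big_map big_filter /S -sumrN.
    apply: eq_bigr => b _.
    by rewrite pairing_refl // refl_self // pairingNr.
  by lra.
rewrite add0r (big_rem a) //= refl_self // (pos_opp hP) // ap /=.
rewrite pairing_self //; apply: ltr_wpDr; last by [].
rewrite big_seq_cond sumr_ge0 // => b /andP [/mem_rem bp h].
exact/ltW/pairing_refl_npos.
Qed.

(** The values of [form rho2] lie in an ordered field, which is not well founded; the measure is the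
    number of positive roots of smaller value. *)
Lemma pos_ind (T : V -> Prop) :
  (forall b, b \in Rp ->
     (forall c, c \in Rp -> form rho2 c < form rho2 b -> T c) -> T b) ->
  forall b, b \in Rp -> T b.
Proof.
move=> h b.
have [k] := ubnP (count (fun c => form rho2 c < form rho2 b) Rp).
elim: k b => // k ih b bk bp; apply: h => // c cp cb; apply: ih => //.
rewrite -ltnS; apply: leq_trans bk; rewrite ltnS.
rewrite -!size_filter; have cu := fset_uniq Rp.
rewrite -[X in (X <= _)%N]/(size (c :: [seq d <- Rp | form rho2 d < form rho2 c])).
apply: uniq_leq_size.
  by rewrite /= mem_filter ltxx /= filter_uniq.
move=> d; rewrite inE !mem_filter => /predU1P [-> | /andP [dc ->]].
  by rewrite cb cp.
by rewrite (lt_trans dc cb).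
Qed.

Record is_base n (a : 'I_n -> V) : Prop := IsBase {
  base_pos : forall i, a i \in Rp;
  base_free : forall x : 'I_n -> K,
    \sum_i x i *: a i = 0 -> forall i, x i = 0;
  base_comb : forall b, b \in Rp -> exists m : 'I_n -> nat, b = \sum_i a i *+ m i
}.

Definition simple (a : V) : Prop :=
  a \in Rp /\ forall b c, b \in Rp -> c \in Rp -> a <> b + c.

(** At an acute angle the difference would be a root, and its positive sign would decompose [a] or
    [b]. *)
Lemma simple_obtuse a b : simple a -> simple b -> a != b -> form a b <= 0.
Proof.
move=> [ap ha] [bp hb] ab; rewrite leNgt; apply/negP => f0.
have r : a - b \in R by apply: (root_sub hR (root_of_pos ap) (root_of_pos bp)).
case: (pos_or_opp r) => rp.
  by case: (ha _ _ rp bp); rewrite subrK.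
by case: (hb _ _ rp ap); rewrite opprB subrK.
Qed.

(** Moving the negative coefficients to the other side writes one vector [v] in two ways, with
    disjoint supports and nonnegative coefficients. Obtuseness gives [form v v <= 0], so [v = 0],
    and pairing with [rho2] kills each coefficient. *)
Lemma obtuse_free n (a : 'I_n -> V) :
  injective a -> (forall i, simple (a i)) -> forall x : 'I_n -> K,
  \sum_i x i *: a i = 0 -> forall i, x i = 0.
Proof.
move=> ainj asim.
suff npos (x : 'I_n -> K) : \sum_i x i *: a i = 0 -> forall i, x i <= 0.
  move=> x x0 i; apply/le_anti; rewrite npos //= -oppr_le0.
  apply: (npos (fun i => - x i)).
  by rewrite -[RHS]oppr0 -[in RHS]x0 -sumrN; apply: eq_bigr => j _; rewrite scaleNr.
move=> x0.
pose p i := Num.max (x i) 0; pose q i := Num.max (- x i) 0.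
have xE i : x i = p i - q i.
  by rewrite /p /q; case: (leP (x i) 0); case: (leP (- x i) 0) => *; lra.
have p0 i : 0 <= p i by rewrite /p le_max lexx orbT.
have q0 i : 0 <= q i by rewrite /q le_max lexx orbT.
have pq i : p i * q i = 0.
  rewrite /p /q; case: (leP (x i) 0) => h1; first by rewrite mul0r.
  by case: (leP (- x i) 0) => h2; rewrite ?mulr0 //; lra.
set v := \sum_i p i *: a i.
have vw : v = \sum_i q i *: a i.
  apply/eqP; rewrite -subr_eq0 -sumrB; apply/eqP; rewrite -[RHS]x0.
  apply: eq_bigr => i _.
  by rewrite xE scalerBl.
have v0 : v = 0.
  apply/eqP/negP => /negP /(form_gt0 form); rewrite ltNge => /negP; apply.
  rewrite {2}vw /v form_suml -oppr_ge0 -sumrN sumr_ge0 // => i _.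
  rewrite form_sumr -sumrN sumr_ge0 // => j _.
  rewrite formZl formZr mulrA.
  have [->|ij] := eqVneq i j; first by rewrite pq mul0r oppr0.
  rewrite oppr_ge0 mulr_ge0_le0 ?mulr_ge0 //.
  by apply: simple_obtuse => //; apply: contra_neq ij => /ainj.
have /eqP := congr1 (form rho2) v0.
rewrite form_sumr -(scale0r (0 : V)) formZr mul0r psumr_eq0 => [/allP h i|i _].
  have := h i (mem_index_enum _); rewrite formZr mulf_eq0.
  rewrite [X in _ || X]gt_eqF ?orbF ?rho2_gt0 ?(proj1 (asim i)) //.
  have : x i <= p i by rewrite /p le_max lexx.
  by move=> + /eqP pi0; rewrite pi0.
by rewrite formZr mulr_ge0 // ltW // rho2_gt0 // (proj1 (asim i)).
Qed.

(** The base consists of the indecomposable positive roots. A decomposable root is a sum of two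
    positive roots of smaller [rho2]-value, so [pos_ind] gives its coordinates. *)
Lemma base_exists : exists n (a : 'I_n -> V), is_base a.
Proof.
pose s := [seq b <- Rp | `[< simple b >]].
have su : uniq s by exact/filter_uniq/fset_uniq.
have sP b : b \in s -> simple b by rewrite mem_filter => /andP [/asboolP].
exists (size s), (fun i : 'I_(size s) => s`_i).
have sim (i : 'I_(size s)) : simple s`_i by apply/sP/mem_nth.
split.
- by move=> i; case: (sim i).
- apply: obtuse_free => // i j /eqP.
  by rewrite nth_uniq // => /eqP /ord_inj.
apply: pos_ind => b bp ih.
have [bs | bn] := pselect (simple b).
  have bi : b \in s by rewrite mem_filter bp andbT; apply/asboolP.
  have lt : (index b s < size s)%N by rewrite index_mem.
  exists (fun i => (i == Ordinal lt) : nat).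
  rewrite (bigD1 (Ordinal lt)) //= eqxx nth_index // big1 ?addr0 // => i.
  by move/negPf => ->.
have [c [d [cp dp e]]] : exists c d, [/\ c \in Rp, d \in Rp & b = c + d].
  apply: contrapT => h; apply: bn; split=> // c d cp dp e; apply: h.
  by exists c, d.
have h1 := rho2_gt0 cp; have h2 := rho2_gt0 dp.
have [|m mE] := ih c cp; first by rewrite e formDr; lra.
have [|m' m'E] := ih d dp; first by rewrite e formDr; lra.
exists (fun i => m i + m' i)%N.
by rewrite e mE m'E -big_split; apply: eq_bigr => i _; rewrite mulrnDr.
Qed.

End PositiveSystems.

(** * Simple reflections generate the roots *)

Section Base.

Variables (K : realFieldType) (V : vectType K) (form : {dot V for idfun}).
Variables (R Rp : {fset V}).
Hypotheses (hR : root_system form R) (hP : positive_roots R Rp).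
Variables (n : nat) (a : 'I_n -> V).
Hypothesis ha : is_base Rp a.
Local Notation pairing := (pairing form).
Local Notation refl := (reflection form).

Lemma base_root i : a i \in R.
Proof. exact/(root_of_pos hP)/(base_pos ha). Qed.

Lemma base_neq0 i : a i != 0.
Proof. exact/(root_nz hR)/base_root. Qed.

Lemma base_coord_inj (x y : 'I_n -> K) :
  \sum_i x i *: a i = \sum_i y i *: a i -> forall i, x i = y i.
Proof.
move=> /eqP; rewrite -subr_eq0 -sumrB => /eqP h i; apply/eqP; rewrite -subr_eq0.
apply/eqP; apply: (base_free ha (x := fun i => x i - y i)).
by rewrite -[RHS]h; apply: eq_bigr => j _; rewrite scalerBl.
Qed.

(** The scalar is a coordinate, hence natural, and [2 / t] is the pairing of [a i] with the root
    [t *: a i], hence an integer. *)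
Lemma base_scale_pos i t : t *: a i \in Rp -> t = 1 \/ t = 2.
Proof.
move=> tp; have [m mE] := base_comb ha tp.
have t0 : t != 0.
  by apply: contraTneq (pos_neq0 hR hP tp) => ->; rewrite scale0r eqxx.
have tm : t = (m i)%:R.
  have := @base_coord_inj (fun j => if j == i then t else 0) (fun j => (m j)%:R).
  move=> /(_ _ i); rewrite eqxx; apply.
  rewrite (bigD1 i) //= eqxx big1 => [|j /negPf ->]; last by rewrite scale0r.
  by rewrite addr0 mE; apply: eq_bigr => j _; rewrite scaler_nat.
have := root_int hR (root_of_pos hP tp) (base_root i).
rewrite pairingZr pairing_self ?base_neq0 // => h.
have tg : 0 < t by rewrite tm ltr0n lt0n -(pnatr_eq0 K) -tm.
have : 1 <= t^-1 * 2 by apply: is_integer_gt0 => //; rewrite mulr_gt0 ?invr_gt0.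
rewrite mulrC ler_pdivlMr // mul1r tm ler_nat => m2.
have : (0 < m i)%N by rewrite -(ltr0n K) -tm.
by case: (m i) m2 => [|[|[|]]] // _ _; [left | right].
Qed.

(** Since [form b b > 0], some [a i] has positive product with [b]. Unless [b] is a multiple of
    [a i], the reflection in [a i] keeps [b] positive and lowers its [rho2]-value. The doubled
    simple roots are starting points because no simple reflection chain from simple roots reaches
    them. *)
Lemma base_ind (T : V -> Prop) :
  (forall i, T (a i)) -> (forall i, 2 *: a i \in R -> T (2 *: a i)) ->
  (forall i b, b \in R -> T b -> T (refl (a i) b)) ->
  forall b, b \in Rp -> T b.
Proof.
move=> h1 h2 hr; apply: (pos_ind (form := form)) => b bp ih.
have [m mE] := base_comb ha bp; have bR := root_of_pos hP bp.
have [i fi] : exists i, 0 < form b (a i).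
  apply: contrapT => /forallNP h.
  have := form_gt0 form (pos_neq0 hR hP bp); rewrite {2}mE form_sumr ltNge.
  move=> /negP; apply; rewrite -oppr_ge0 -sumrN sumr_ge0 // => i _.
  have /negP := h i; rewrite -leNgt => hi.
  by rewrite -scaler_nat formZr oppr_ge0 mulr_ge0_le0.
have [/existsP [j /andP [ji mj]] | /existsPn all0] :=
    boolP [exists j, (j != i) && (0 < m j)%N]; last first.
  have bE : b = (m i)%:R *: a i.
    rewrite mE (bigD1 i) //= big1 ?addr0 ?scaler_nat // => j ji.
    by have := all0 j; rewrite ji lt0n negbK => /eqP ->.
  rewrite bE in bp *.
  have [e|e] := base_scale_pos bp; rewrite e ?scale1r //.
  by apply: h2; rewrite -e; apply: root_of_pos bp.
have cR : refl (a i) b \in R by apply: refl_root => //; apply: base_root.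
have cp : refl (a i) b \in Rp.
  case: (pos_or_opp hP cR) => // /(base_comb ha) [m' m'E]; exfalso.
  (* If the reflected root were negative, [b] minus it would have both the coordinates [m + m'] and
     the single coordinate [pairing b (a i)] at [i], which contradicts [0 < m j]. *)
  pose x l := (m l)%:R + (m' l)%:R - (if l == i then pairing b (a i) else 0).
  have : x j = 0.
    apply: (base_free ha); rewrite /x.
    under eq_bigr => l _ do rewrite scalerBl scalerDl !scaler_nat.
    rewrite sumrB big_split /= -mE -m'E [X in _ - X](bigD1 i) //= eqxx.
    rewrite [X in _ - (_ + X)]big1 => [|l /negPf ->]; last by rewrite scale0r.
    by rewrite addr0 /reflection opprB addrCA subrr addr0 subrr.
  rewrite /x (negPf ji) subr0 -natrD => /eqP; rewrite pnatr_eq0 addn_eq0.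
  by move: mj; rewrite lt0n => /negPf ->.
rewrite -(reflK form (base_neq0 i) b); apply: hr => //; apply: ih => //.
rewrite /reflection formDr formNr formZr gtrBl mulr_gt0 //.
  by rewrite pairing_gt0 ?base_neq0.
by rewrite (rho2_gt0 hR hP) ?(base_pos ha).
Qed.

Lemma base_ind_root (T : V -> Prop) :
  (forall b, T b -> T (- b)) ->
  (forall i, T (a i)) -> (forall i, 2 *: a i \in R -> T (2 *: a i)) ->
  (forall i b, b \in R -> T b -> T (refl (a i) b)) ->
  forall b, b \in R -> T b.
Proof.
move=> hN h1 h2 hr b bR; have hp := base_ind h1 h2 hr.
by case: (pos_or_opp hP bR) => /hp // /hN; rewrite opprK.
Qed.

End Base.

(** * Admissible and quadratic lattices *)

Section Lattices.

Variables (K : realFieldType) (V : vectType K) (R : {fset V}).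

Section Subgroups.

Variable S : set V.
Hypotheses (S0 : S 0) (SB : forall x y, S x -> S y -> S (x - y)).

Lemma subgroupN x : S x -> S (- x).
Proof. by move=> Sx; rewrite -sub0r; apply: SB. Qed.

Lemma subgroupD x y : S x -> S y -> S (x + y).
Proof. by move=> Sx Sy; rewrite -[y]opprK; apply/SB/subgroupN. Qed.

Lemma subgroupMz x (z : int) : S x -> S (x *~ z).
Proof.
have nat_case (m : nat) : S x -> S (x *+ m).
  by move=> Sx; elim: m => // m ih; rewrite mulrS; apply: subgroupD.
by case: z => m Sx; [exact: nat_case | apply/subgroupN/nat_case].
Qed.

Lemma subgroup_sum I (r : seq I) (P : pred I) (F : I -> V) :
  (forall i, P i -> S (F i)) -> S (\sum_(i <- r | P i) F i).
Proof. by move=> h; elim/big_ind: _ => // x y; apply: subgroupD. Qed.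

Lemma root_lattice_sub : (forall b, b \in R -> S b) -> subset (root_lattice R) S.
Proof.
move=> h x [c ->]; rewrite big_seq_cond; apply: subgroup_sum => b /andP [bR _].
exact/subgroupMz/h.
Qed.

End Subgroups.

Lemma root_lattice0 : root_lattice R 0.
Proof. by exists (fun=> 0); rewrite big1. Qed.

Lemma root_latticeB x y :
  root_lattice R x -> root_lattice R y -> root_lattice R (x - y).
Proof.
move=> [c ->] [d ->]; exists (fun b => c b - d b).
by rewrite -sumrB; apply: eq_bigr => b _; rewrite mulrzBr.
Qed.

Lemma root_lattice_root b : b \in R -> root_lattice R b.
Proof.
move=> bR; exists (fun c => if c == b then 1 else 0).
rewrite (bigD1_seq b) ?fset_uniq //= eqxx big1 ?addr0 // => c /negPf ->.
by rewrite mulr0z.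
Qed.

Lemma root_lattice_comb I (r : seq I) (f : I -> V) (z : I -> int) :
  (forall i, f i \in R) -> root_lattice R (\sum_(i <- r) f i *~ z i).
Proof.
move=> h; apply: subgroup_sum => [||i _]; first exact: root_lattice0.
  exact: root_latticeB.
apply: subgroupMz; [exact: root_lattice0 | exact: root_latticeB |].
exact: root_lattice_root.
Qed.

End Lattices.

(** * Fundamental weights and integrality tested on a base *)

Section DualBasis.

Variables (K : realFieldType) (V : vectType K) (form : {dot V for idfun}).
Variables (R Rp : {fset V}).
Hypotheses (hR : root_system form R) (hP : positive_roots R Rp).
Variables (n : nat) (a : 'I_n -> V).
Hypothesis ha : is_base Rp a.
Local Notation pairing := (pairing form).
Local Notation refl := (reflection form).
Let aR := base_root hP ha.
Let a0 := base_neq0 hR hP ha.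

(** The difference [a i - a j] has coordinates of both signs, so neither it nor its opposite is a
    positive root; being no root, it contradicts [root_sub] at an acute angle. *)
Lemma base_obtuse i j : i != j -> form (a i) (a j) <= 0.
Proof.
move=> ij; rewrite leNgt; apply/negP => f0.
have aij : a i != a j.
  apply: contra_neq ij => e; apply/eqP/negP => /negP ij.
  have := base_coord_inj ha (x := fun l => (l == i)%:R) (y := fun l => (l == j)%:R).
  rewrite (bigD1 i) //= eqxx scale1r big1 => [|l /negPf ->]; last by rewrite scale0r.
  rewrite (bigD1 j) //= eqxx scale1r big1 => [|l /negPf ->]; last by rewrite scale0r.
  rewrite !addr0 => /(_ e i) /eqP; rewrite eqxx (negPf ij).
  by rewrite oner_eq0.
have main k l : k != l -> a k - a l \notin Rp.
  move=> kl; apply/negP => /(base_comb ha) [m mE].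
  have := base_coord_inj ha (x := fun t => (t == k)%:R - (t == l)%:R) (y := fun t => (m t)%:R).
  under eq_bigr do rewrite scalerBl.
  rewrite sumrB (bigD1 k) //= eqxx scale1r big1 => [|t /negPf ->]; last by rewrite scale0r.
  rewrite (bigD1 l) //= eqxx scale1r big1 => [|t /negPf ->]; last by rewrite scale0r.
  rewrite !addr0 mE; under [X in _ = X -> _]eq_bigr do rewrite scaler_nat.
  move=> /(_ erefl l); rewrite eqxx eq_sym (negPf kl) sub0r => h.
  by have := ler0n K (m l); rewrite -h lerNr oppr0 ler10.
have r : a i - a j \in R by apply: (root_sub hR (aR i) (aR j)).
case: (pos_or_opp hP r); first by apply/negP/main.
by rewrite opprB; apply/negP/main; rewrite eq_sym.
Qed.

Lemma pairing_base_le0 i j : i != j -> pairing (a i) (a j) <= 0.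
Proof.
by move=> ij; rewrite leNgt pairing_gt0 // -leNgt base_obtuse.
Qed.

Lemma pairing_base_int i j : is_integer (pairing (a i) (a j)).
Proof. exact: (root_int hR (aR j) (aR i)). Qed.

Lemma base_span v : exists x : 'I_n -> K, v = \sum_i x i *: a i.
Proof.
have /coord_span -> : v \in <<in_tuple (enum_fset R)>>%VS.
  by rewrite (root_span hR) memvf.
elim/big_ind: _ => [|u w [x ->] [y ->]|i _].
- by exists (fun=> 0); rewrite big1 // => i _; rewrite scale0r.
- exists (fun i => x i + y i).
  by rewrite -big_split; apply: eq_bigr => i _; rewrite scalerDl.
set t := coord _ _ _; set b := _`_i.
have bR : b \in R by apply: mem_nth.
case: (pos_or_opp hP bR) => /(base_comb ha) [m mE].
  exists (fun i => t * (m i)%:R).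
  by rewrite mE scaler_sumr; apply: eq_bigr => j _; rewrite -scaler_nat scalerA.
exists (fun i => - t * (m i)%:R).
rewrite -[b]opprK mE scalerN -scaleNr scaler_sumr.
by apply: eq_bigr => j _; rewrite -scaler_nat scalerA.
Qed.

Lemma pairing_base_inj u v :
  (forall i, pairing u (a i) = pairing v (a i)) -> u = v.
Proof.
move=> h; apply/eqP; rewrite -subr_eq0; apply/negP => /negP nz.
have [x xE] := base_span (u - v).
have := form_gt0 form nz; rewrite {2}xE form_sumr big1 ?ltxx // => i _.
rewrite formZr; apply/eqP; rewrite mulf_eq0 -(pairing_eq0 form _ (a0 i)).
by rewrite pairingBl h subrr eqxx orbT.
Qed.

(** These are multiples of the fundamental weights that lie in the root lattice. The adjugate of the
    Cartan matrix gives them with factor the determinant; one more factor of the determinant makes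
    [d] its square, hence positive whatever its sign. *)
Lemma base_dual : exists2 d : nat, (0 < d)%N &
  exists z : 'I_n -> 'I_n -> int, forall i k,
    pairing (\sum_j a j *~ z i j) (a k) = if i == k then d%:R else 0.
Proof.
pose Cz : 'M[int]_n :=
  \matrix_(j, k) projT1 (cid (pairing_base_int j k)).
have CzE j k : (Cz j k)%:~R = pairing (a j) (a k).
  by rewrite mxE; case: cid.
have free : row_free (map_mx intr Cz : 'M[K]_n).
  apply: inj_row_free => x x0.
  have s0 : \sum_j x 0 j *: a j = 0.
    apply: pairing_base_inj => k; rewrite pairing_suml pairing0l.
    move/rowP/(_ k): x0; rewrite mxE [in RHS]mxE => h; rewrite -[RHS]h.
    by apply: eq_bigr => j _; rewrite pairingZl [in RHS]mxE CzE.
  by apply/rowP => j; rewrite mxE (base_free ha s0).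
have det0 : \det Cz != 0.
  rewrite -(intr_eq0 K) -det_map_mx -unitfE.
  by move: free; rewrite row_free_unit unitmxE.
exists (`|\det Cz| ^ 2)%N; first by rewrite expn_gt0 absz_gt0 det0.
exists (fun i j => \det Cz * (\adj Cz) i j) => i k.
rewrite pairing_suml.
have := congr1 (fun M : 'M_n => \det Cz * M i k) (mul_adj_mx Cz).
rewrite /= !mxE => /(congr1 (fun z : int => z%:~R : K)) h.
have -> : (if i == k then (`|\det Cz| ^ 2)%N%:R else 0) =
    ((\det Cz * (\det Cz *+ (i == k)))%:~R : K).
  case: (i == k); last by rewrite mulr0n mulr0.
  by rewrite mulr1n -expr2 -abszX pmulrn gez0_abs // sqr_ge0.
rewrite -h mulr_sumr rmorph_sum /=; apply: eq_bigr => j _.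
by rewrite -scaler_int pairingZl !rmorphM /= CzE mulrA.
Qed.

Lemma base_dual_vectors (c : 'I_n -> nat) : exists w : 'I_n -> V, forall i k,
  pairing (w i) (a k) = if i == k then (c i)%:R else 0.
Proof.
have [d d0 [z zE]] := base_dual.
exists (fun i => ((c i)%:R / d%:R) *: \sum_j a j *~ z i j) => i k.
rewrite pairingZl zE; case: eqP => _; last by rewrite mulr0.
by rewrite divfK // pnatr_eq0 -lt0n.
Qed.

(** Integrality spreads from the simple roots and their doubles to all roots, because a reflection
    of the root can be moved to the weight and preserves the conditions on it. *)
Lemma weight_latticeP l : weight_lattice form R l <->
  forall i, is_integer (pairing l (a i)) /\
    (2 *: a i \in R -> is_integer (pairing l (a i) / 2)).
Proof.
split=> [h i|].
  split=> [|/h]; first exact/h/aR.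
  by rewrite pairingZr mulrC.
(* The weight is kept general, since the reflection step applies the hypothesis to a reflected
   weight. *)
move=> hl b bR; move: b bR l hl.
apply: (base_ind_root hR hP ha) => [b ih l hl|i l hl|i i2 l hl|i b bR ih l hl].
- by rewrite pairingNr; apply/is_integerN/ih.
- by case: (hl i).
- have [_ /(_ i2) li2] := hl i; by rewrite pairingZr mulrC.
rewrite -pairing_refl //; apply: ih => j.
rewrite /reflection pairingBl pairingZl.
have [li _] := hl i; have [lj lj2] := hl j.
split=> [|j2]; first exact/is_integerB/is_integerM/pairing_base_int.
rewrite mulrBl; apply: is_integerB; first exact: lj2 j2.
rewrite -mulrA; apply: is_integerM => //.
by have := root_int hR j2 (aR i); rewrite pairingZr mulrC.
Qed.

(** Coroots are not additive in the root; their signs are those of [form], which is additive. *)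
Lemma dominantP l : dominant_weights form R Rp l <->
  weight_lattice form R l /\ forall i, 0 <= pairing l (a i).
Proof.
have sgn u b : b \in Rp -> (0 <= pairing u b) = (0 <= form u b).
  by move=> bp; rewrite !leNgt pairing_lt0 // (pos_neq0 hR hP bp).
split=> [] [lP h]; split=> //; first by move=> i; apply/h/(base_pos ha).
move=> b bp.
rewrite sgn //; have [m ->] := base_comb ha bp.
rewrite form_sumr sumr_ge0 // => i _; rewrite -scaler_nat formZr mulr_ge0 //.
by rewrite -sgn ?(base_pos ha).
Qed.

End DualBasis.

Section MonoidBasis.

Variables (K : realFieldType) (V : vectType K).
Variables (M : set V) (B : {fset V}).
Hypothesis hB : monoid_basis M B.

Lemma monoid_basis_comb x : M x <->
  exists c : {ffun B -> nat}, x = \sum_(e : B) val e *+ c e.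
Proof.
have [_ <-] := hB; split=> [[c _ <-]|[c ->]]; first by exists c.
by exists c.
Qed.

Lemma monoid_basis_inj (c d : {ffun B -> nat}) :
  \sum_(e : B) val e *+ c e = \sum_(e : B) val e *+ d e -> c = d.
Proof. by have [inj _] := hB; apply: inj. Qed.

Lemma comb_single (e : B) k :
  \sum_(f : B) val f *+ [ffun f => if f == e then k else 0%N] f = val e *+ k.
Proof.
rewrite (bigD1 e) //= ffunE eqxx big1 ?addr0 // => f /negPf fe.
by rewrite ffunE fe.
Qed.

Lemma monoid_basis_mem (e : B) : M (val e).
Proof.
apply/monoid_basis_comb; exists [ffun f => if f == e then 1%N else 0%N].
by rewrite comb_single.
Qed.

Lemma monoid_basis_neq0 (e : B) : val e != 0.
Proof.
apply/negP => /eqP e0.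
have /monoid_basis_inj/ffunP/(_ e) :
    \sum_(f : B) val f *+ [ffun f => if f == e then 1%N else 0%N] f =
    \sum_(f : B) val f *+ [ffun=> 0%N] f.
  by rewrite comb_single e0 mul0rn big1 // => f _; rewrite ffunE.
by rewrite !ffunE eqxx.
Qed.

End MonoidBasis.

(** * Lattices with a free dominant monoid, and their height *)

Section Admissible.

Variables (K : realFieldType) (V : vectType K) (form : {dot V for idfun}).
Variables (R Rp : {fset V}).
Hypotheses (hR : root_system form R) (hP : positive_roots R Rp).
Variables (n : nat) (a : 'I_n -> V).
Hypothesis ha : is_base Rp a.
Local Notation pairing := (pairing form).
Local Notation refl := (reflection form).
Let aR := base_root hP ha.
Let a0 := base_neq0 hR hP ha.

Definition scaled_lattice (c : 'I_n -> nat) : set V :=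
  [set l | forall i, is_integer (pairing l (a i) / (c i)%:R)]%classic.

(* An admissible lattice has basis [c i] times the i-th fundamental weight. *)
Record multipliers (c : 'I_n -> nat) : Prop := Multipliers {
  mult_or : forall i, c i = 1%N \/ c i = 2%N;
  mult_double : forall i, 2 *: a i \in R -> c i = 2%N;
  mult_int : forall i j, is_integer (pairing (a j) (a i) / (c i)%:R)
}.

Definition dual_basis (c : 'I_n -> nat) (B : {fset V}) : Prop :=
  forall e, e \in B <->
    exists i, forall j, pairing e (a j) = if i == j then (c i)%:R else 0.

Definition height (c : 'I_n -> nat) (v : V) : K :=
  \sum_i pairing v (a i) / (c i)%:R.

Lemma heightD c u v : height c (u + v) = height c u + height c v.
Proof.
by rewrite /height -big_split; apply: eq_bigr => i _; rewrite pairingDl mulrDl.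
Qed.

Lemma heightZ c k v : height c (k *: v) = k * height c v.
Proof.
by rewrite /height mulr_sumr; apply: eq_bigr => i _; rewrite pairingZl !mulrA.
Qed.

Lemma heightN c v : height c (- v) = - height c v.
Proof. by rewrite -scaleN1r heightZ mulN1r. Qed.

Lemma heightMn c v k : height c (v *+ k) = height c v * k%:R.
Proof. by rewrite -scaler_nat heightZ mulrC. Qed.

Lemma height0 c : height c 0 = 0.
Proof. by rewrite -(scale0r (0 : V)) heightZ mul0r. Qed.

Lemma height_sum c I (r : seq I) (P : pred I) (F : I -> V) :
  height c (\sum_(i <- r | P i) F i) = \sum_(i <- r | P i) height c (F i).
Proof. exact: (big_morph _ (heightD c) (height0 c)). Qed.

Lemma mult_neq0 c : multipliers c -> forall i, (c i)%:R != 0 :> K.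
Proof. by move=> hc i; rewrite pnatr_eq0; case: (mult_or hc i) => ->. Qed.

Lemma scaled_lattice0 c : scaled_lattice c 0.
Proof. by move=> i; rewrite pairing0l mul0r; apply: is_integer0. Qed.

Lemma scaled_latticeB c u v :
  scaled_lattice c u -> scaled_lattice c v -> scaled_lattice c (u - v).
Proof. by move=> hu hv i; rewrite pairingBl mulrBl; apply: is_integerB. Qed.

Lemma scaled_lattice_weight c :
  multipliers c -> subset (scaled_lattice c) (weight_lattice form R).
Proof.
move=> hc l hl; apply/(weight_latticeP hR hP ha) => i; split=> [|i2].
  rewrite -[pairing _ _](divfK (mult_neq0 hc i)).
  exact/is_integerM/is_integer_nat.
by have := hl i; rewrite (mult_double hc i2).
Qed.

Lemma scaled_lattice_root c :
  multipliers c -> subset (root_lattice R) (scaled_lattice c).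
Proof.
move=> hc; apply: root_lattice_sub; first exact: scaled_lattice0.
  by move=> x y; apply: scaled_latticeB.
move=> b bR i.
have pos d : d \in Rp -> is_integer (pairing d (a i) / (c i)%:R).
  move=> /(base_comb ha) [m ->].
  rewrite pairing_suml mulr_suml; apply: is_integer_sum => j.
  rewrite pairingMnl mulrAC; apply: is_integerM; last exact: is_integer_nat.
  exact: mult_int.
case: (pos_or_opp hP bR) => /pos //.
by rewrite pairingNl mulNr => /is_integerN; rewrite opprK.
Qed.

Lemma dominant_scaledP c l : multipliers c ->
  dominant_part form R Rp (scaled_lattice c) l <->
  forall i, exists m : nat, pairing l (a i) / (c i)%:R = m%:R.
Proof.
move=> hc; have cn := mult_neq0 hc; split=> [[hl hd] i|h].
  apply: is_integer_ge0_nat; first exact: hl.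
  have /(dominantP hR hP ha) [_ h] := hd.
  exact: divr_ge0.
have hl : scaled_lattice c l.
  by move=> i; have [m ->] := h i; apply: is_integer_nat.
split=> //; apply/(dominantP hR hP ha); split; first exact: (scaled_lattice_weight hc hl).
move=> i; have [m mE] := h i.
by rewrite -[pairing _ _](divfK (cn i)) mE mulr_ge0.
Qed.

(** The basis consists of the vectors dual to the coroots divided by [c]: in their coordinates the
    dominant part becomes all vectors of natural numbers. *)
Lemma scaled_admissible c : multipliers c ->
  admissible form R Rp (scaled_lattice c).
Proof.
move=> hc; have cn := mult_neq0 hc.
split.
- split; [exact: (scaled_lattice_weight hc) | exact: scaled_lattice0 |].
  by move=> x y; apply: scaled_latticeB.
- exact: (scaled_lattice_root hc).
have [w wE] := base_dual_vectors hR hP ha c.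
have winj : injective w.
  move=> i j e; apply/eqP/negP => /negP ij.
  have := wE i j; rewrite e wE eqxx (negPf ij) => /eqP.
  by rewrite (negPf (cn j)).
pose B := [fset w i | i in 'I_n]%fset.
have wB i : w i \in B by apply/imfsetP; exists i.
exists B; split.
- move=> x y /= exy; apply/ffunP => e.
  have [i _ eE] : exists2 i, i \in 'I_n & val e = w i.
    by have /imfsetP [i] := valP e; exists i.
  have coef (z : {ffun B -> nat}) :
      pairing (\sum_(f : B) val f *+ z f) (a i) = (c i)%:R * (z e)%:R.
    rewrite pairing_suml (bigD1 e) //= big1 => [|f fe].
      by rewrite pairingMnl eE wE eqxx addr0.
    have /imfsetP [j _ fE] := valP f.
    rewrite pairingMnl fE wE; case: eqP => [ji|]; last by rewrite mul0r.
    by case/eqP: fe; apply/val_inj; rewrite fE ji eE.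
  have := congr1 (pairing^~ (a i)) exy; rewrite !coef => /(mulfI (cn i)) /eqP.
  by rewrite eqr_nat => /eqP.
apply/seteqP; split=> [l [x _ <-]|l /(dominant_scaledP _ hc) h].
  apply/(dominant_scaledP _ hc) => i.
  have wi := wB i.
  exists (x [`wi]%fset).
  rewrite pairing_suml (bigD1 [`wi]%fset) //= big1 => [|f fe].
    by rewrite addr0 pairingMnl wE eqxx mulrAC mulfV // mul1r.
  have /imfsetP [j _ fE] := valP f.
  rewrite pairingMnl fE wE; case: eqP => [ji|]; last by rewrite mul0r.
  by case/eqP: fe; apply/val_inj; rewrite /= fE ji.
have [m mE] := choice h.
have iP (e : B) : exists i, val e = w i.
  by have /imfsetP [i _ eE] := valP e; exists i.
have [f fE] := choice iP.
exists [ffun e => m (f e)] => //.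
apply: (pairing_base_inj hR hP ha) => i.
have wi := wB i.
rewrite pairing_suml (bigD1 [`wi]%fset) //= big1 => [|e ne].
  rewrite addr0 pairingMnl wE eqxx ffunE.
  have -> : f [`wi]%fset = i by apply: winj; rewrite -fE.
  by rewrite -mE mulrC divfK.
rewrite pairingMnl fE wE; case: eqP => [ji|]; last by rewrite mul0r.
by case/eqP: ne; apply/val_inj; rewrite fE ji.
Qed.

(** The root lattice contains a multiple [u i] of each fundamental weight. It is a sum of basis
    elements, all dominant, so those that occur lie on the same ray; one of them is [c i] times the
    weight. Uniqueness of expansions shows that [B] has no other elements. *)
Lemma admissible_scaled L B :
  sublattice L (weight_lattice form R) -> subset (root_lattice R) L ->
  monoid_basis (dominant_part form R Rp L) B ->
  exists c, [/\ multipliers c, L = scaled_lattice c & dual_basis c B].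
Proof.
move=> [LP L0 LB] QL hB.
have [d d0 [z zE]] := base_dual hR hP ha.
have dn0 : d%:R != 0 :> K by rewrite pnatr_eq0 -lt0n.
pose u i := \sum_j a j *~ z i j.
have uL i : L (u i) by apply/QL/root_lattice_comb.
have udom i : dominant_part form R Rp L (u i).
  split=> //; apply/(dominantP hR hP ha); split; first exact: LP.
  by move=> j; rewrite zE; case: eqP.
have eL (e : B) : L (val e) by have [] := monoid_basis_mem hB e.
have ege0 (e : B) i : 0 <= pairing (val e) (a i).
  by have [_ /(dominantP hR hP ha) []] := monoid_basis_mem hB e.
(* The pair records the multiplier and the element of [B] on the ray of [u i]. *)
have wP i : exists cw : nat * B, (0 < cw.1)%N /\
    forall j, pairing (val cw.2) (a j) = if i == j then cw.1%:R else 0.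
  have /(monoid_basis_comb hB) [m mE] := udom i.
  have [e me] : exists e, (0 < m e)%N.
    apply: contrapT => /forallNP h.
    have := zE i i; rewrite -/(u i) mE eqxx big1 => [|e _].
      by rewrite pairing0l => /esym/eqP; rewrite (negPf dn0).
    by have /negP := h e; rewrite lt0n negbK => /eqP ->.
  have off j : i != j -> pairing (val e) (a j) = 0.
    move=> ij; have := zE i j; rewrite -/(u i) mE (negPf ij) pairing_suml => /eqP.
    rewrite psumr_eq0 => [/allP /(_ e (mem_index_enum _))|f _]; last first.
      by rewrite pairingMnl mulr_ge0.
    rewrite pairingMnl mulf_eq0 pnatr_eq0 => /orP [/eqP //|/eqP m0].
    by rewrite m0 in me.
  have eP : is_integer (pairing (val e) (a i)) by apply: LP (eL e) _ _.
  have [k kE] := is_integer_ge0_nat eP (ege0 e i).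
  exists (k, e); split=> /=; last first.
    by move=> j; case: eqP => [<- //|/eqP /off].
  rewrite lt0n; apply/negP => /eqP k0.
  have := monoid_basis_neq0 hB e; case/eqP.
  apply: (pairing_base_inj hR hP ha) => j; rewrite pairing0l.
  have [<-|ij] := eqVneq i j; last exact: off.
  by rewrite kE k0.
have [cw cwP] := choice wP.
pose c i := (cw i).1; pose w i := (cw i).2.
have c0 i : (0 < c i)%N by case: (cwP i).
have wE i j : pairing (val (w i)) (a j) = if i == j then (c i)%:R else 0.
  by case: (cwP i).
have cn i : (c i)%:R != 0 :> K by rewrite pnatr_eq0 -lt0n.
have onB (e : B) : exists i, e = w i.
  have eP i : is_integer (pairing (val e) (a i)) by apply: LP (eL e) _ _.
  have [k kE] := choice (fun i => is_integer_ge0_nat (eP i) (ege0 e i)).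
  (* A common multiple of the multipliers: [N] times [e] is a natural combination of the [w i], and
     comparing both expansions forces [e] to be one of them. *)
  pose N := (\prod_i c i)%N; pose N' i := (\prod_(j | j != i) c j)%N.
  have NE i : N = (c i * N' i)%N by rewrite /N (bigD1 i).
  have N0 : (0 < N)%N by apply: prodn_gt0.
  pose y : {ffun B -> nat} :=
    [ffun f => \sum_i (if f == w i then k i * N' i else 0)]%N.
  have : \sum_(f : B) val f *+ [ffun f => if f == e then N else 0%N] f =
         \sum_(f : B) val f *+ y f.
    rewrite comb_single.
    under [RHS]eq_bigr => f _ do rewrite ffunE -sumrMnr.
    rewrite exchange_big /=; apply: (pairing_base_inj hR hP ha) => i.
    rewrite pairing_suml (bigD1 i) //= [X in _ = _ + X]big1 => [|j ji]; last first.
      rewrite (bigD1 (w j)) //= eqxx big1 => [|f /negPf ->]; last by rewrite mulr0n.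
      by rewrite addr0 pairingMnl wE (negPf ji) mul0r.
    rewrite addr0 (bigD1 (w i)) //= eqxx big1 => [|f /negPf ->]; last by rewrite mulr0n.
    rewrite addr0 !pairingMnl wE eqxx kE (NE i) !natrM.
    by ring.
  move/(monoid_basis_inj hB)/ffunP/(_ e); rewrite !ffunE eqxx => Ny.
  apply: contrapT => /forallNP ne; move: N0; rewrite Ny big1 // => i _.
  by case: eqP => // /ne.
have wL i : L (val (w i)) by apply: eL.
have LD := subgroupD L0 LB.
have LE : L = scaled_lattice c.
  have dom l : dominant_part form R Rp L l -> scaled_lattice c l.
    move=> /(monoid_basis_comb hB) [m ->] i.
    rewrite pairing_suml mulr_suml; apply: is_integer_sum => e.
    rewrite pairingMnl mulrAC; apply: is_integerM; last exact: is_integer_nat.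
    have [j ->] := onB e; rewrite wE; case: eqP => [->|_].
      by rewrite divff //; apply: (is_integer_nat K 1).
    by rewrite mul0r; apply: is_integer0.
  apply/seteqP; split=> l hl.
    have lP i : is_integer (pairing l (a i)) by apply: LP hl _ _.
    have [k kE] := choice lP.
    (* Since [d >= 1], adding [t] raises every coroot value by at least its absolute value; thus [l]
       is the difference of the dominant elements [l + t] and [t]. *)
    pose t := \sum_i u i *+ `|k i|%N.
    have tP i : pairing t (a i) = (d * `|k i|%N)%:R.
      rewrite pairing_suml (bigD1 i) //= big1 => [|j ji].
        by rewrite addr0 pairingMnl zE eqxx natrM.
      by rewrite pairingMnl zE (negPf ji) mul0r.
    have tdom : dominant_part form R Rp L t.
      split; first by apply: subgroup_sum => // i _; apply: (subgroupMz _ _ (Posz _)).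
      apply/(dominantP hR hP ha); split=> [|i]; last by rewrite tP.
      by apply: LP; apply: subgroup_sum => // i _; apply: (subgroupMz _ _ (Posz _)).
    rewrite -[l](addrK t); apply: scaled_latticeB; last exact: dom.
    apply: dom; split; first by apply: LD => //; case: tdom.
    apply/(dominantP hR hP ha); split=> [|i]; first by apply/LP/LD => //; case: tdom.
    rewrite pairingDl tP kE pmulrn -intrD ler0z.
    have : (`|k i| <= d * `|k i|)%N by rewrite leq_pmull.
    by lia.
  have [k kE] := choice hl.
  rewrite (_ : l = \sum_i val (w i) *~ k i).
    by apply: subgroup_sum => // i _; apply: subgroupMz.
  apply: (pairing_base_inj hR hP ha) => i.
  rewrite pairing_suml (bigD1 i) //= big1 => [|j ji].
    by rewrite addr0 -scaler_int pairingZl wE eqxx -kE divfK.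
  by rewrite -scaler_int pairingZl wE (negPf ji) mulr0.
have cint i j : is_integer (pairing (a j) (a i) / (c i)%:R).
  have : L (a j) by apply/QL/root_lattice_root.
  by rewrite LE; apply.
have cor i : c i = 1%N \/ c i = 2%N.
  have /is_integer_gt0 := cint i i; rewrite pairing_self //.
  rewrite divr_gt0 ?ltr0n // => /(_ isT); rewrite ler_pdivlMr ?ltr0n // mul1r.
  by rewrite ler_nat; have := c0 i; case: (c i) => [|[|[|]]] // *; [left | right].
exists c; split=> //.
(* With multiplier 1 the coroot of [2 *: a i] would take the value one half on [w i]. *)
- split=> // i i2; case: (cor i) => // c1.
  have := LP _ (wL i) _ i2; rewrite pairingZr wE eqxx c1 mulr1.
  by move/not_integer_half.
- move=> e; split=> [eB|[i ei]].
    have [i iE] := onB [`eB]%fset; exists i => j.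
    by rewrite -wE -iE.
  rewrite (_ : e = val (w i)); first exact: valP.
  by apply: (pairing_base_inj hR hP ha) => j; rewrite wE ei.
Qed.

(** Whatever coordinates [xget] selects, the linear functional [height] is 1 on every element of [B]
    and so returns their sum. *)
Lemma hgt_height c B l :
  multipliers c -> monoid_basis (dominant_part form R Rp (scaled_lattice c)) B ->
  dual_basis c B -> dominant_part form R Rp (scaled_lattice c) l ->
  (hgt B l)%:~R = height c l.
Proof.
move=> hc hB dB hl; rewrite /hgt.
case: xgetP => [x _ /= lE|none]; last first.
  have /(monoid_basis_comb hB) [m mE] := hl.
  case: (none [ffun e => Posz (m e)]) => /=; rewrite mE.
  by apply: eq_bigr => e _; rewrite ffunE.
rewrite lE height_sum rmorph_sum /=; apply: eq_bigr => e _.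
rewrite -scaler_int heightZ.
have [i iE] := proj1 (dB (val e)) (valP e).
rewrite /height (bigD1 i) //= iE eqxx big1 => [|j ji].
  by rewrite divff ?mult_neq0 // addr0 mulr1.
by rewrite iE eq_sym (negPf ji) mul0r.
Qed.

Theorem quadraticP L : quadratic form R Rp L <->
  exists c, [/\ multipliers c, L = scaled_lattice c
               & forall j, 0 <= height c (a j)].
Proof.
split=> [[[LP QL [B hB]] hq]|[c [hc LE hh]]].
  have [c [hc LE dB]] := admissible_scaled LP QL hB.
  exists c; split=> // j; rewrite leNgt; apply/negP => hj.
  have [w wE] := base_dual_vectors hR hP ha c.
  have wB : w j \in B by apply/dB; exists j.
  pose l := w j + w j - a j.
  have lE i : pairing l (a i) =
      (if j == i then (c i)%:R + (c i)%:R else 0) - pairing (a j) (a i).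
    rewrite pairingBl pairingDl wE; case: eqP => [->|] //.
    by rewrite addr0.
  have ldom : dominant_part form R Rp (scaled_lattice c) l.
    apply/(dominant_scaledP _ hc) => i; apply: is_integer_ge0_nat.
      apply: (scaled_latticeB (c := c)) i; last first.
        exact/scaled_lattice_root/root_lattice_root.
      move=> i; rewrite pairingDl wE; case: eqP => [->|_].
        by rewrite mulrDl divff ?mult_neq0 //; apply: (is_integer_nat K 2).
      by rewrite addr0 mul0r; apply: is_integer0.
    (* At [i = j] the pairing is [2 c_j - 2]; elsewhere it is the opposite of a nonpositive Cartan
       entry. *)
    apply: divr_ge0 => //; rewrite lE; case: eqP => [->|/eqP ji].
      rewrite pairing_self // subr_ge0 -natrD ler_nat.
      by case: (mult_or hc i) => ->.
    by rewrite sub0r oppr_ge0 (pairing_base_le0 hR hP ha).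
  have lle : dominant_le Rp l (w j + w j).
    exists (fun b => (b == a j) : nat).
    rewrite (bigD1_seq (a j)) ?fset_uniq ?(base_pos ha) //= eqxx big1.
      by rewrite addr0 /l opprB addrC subrK.
    by move=> b /negPf ->.
  rewrite -LE in hB ldom.
  have := hq B hB l (w j) (w j) ldom wB wB lle.
  rewrite LE in hB ldom.
  rewrite -(ler_int K) (hgt_height hc hB dB ldom).
  rewrite heightD heightN heightD.
  have -> : height c (w j) = 1.
    rewrite /height (bigD1 j) //= wE eqxx big1 => [|i ij].
      by rewrite divff ?mult_neq0 // addr0.
    by rewrite wE eq_sym (negPf ij) mul0r.
  by move: hj; clear LE => hj h; lra.
split=> [|B hB l e h hl eB hhB le]; first by rewrite LE; apply: scaled_admissible.
rewrite LE in hB hl.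
have [[LP L0 LB] QL _] := scaled_admissible hc.
have [c' [hc' LE' dB]] := admissible_scaled (And3 LP L0 LB) QL hB.
(* The basis [B] is arbitrary and comes with its own multipliers. The lattice determines them: each
   ratio is integral in both directions. *)
have cE i : c i = c' i.
  have dvd (x y : 'I_n -> nat) : scaled_lattice x = scaled_lattice y ->
      is_integer ((x i)%:R / (y i)%:R : K).
    have [w wE] := base_dual_vectors hR hP ha x => xy.
    have : scaled_lattice x (w i).
      move=> j; rewrite wE; case: eqP => [<-|_]; last by rewrite mul0r; apply: is_integer0.
      have [->|x0] := eqVneq ((x i)%:R : K) 0; first by rewrite mul0r; apply: is_integer0.
      by rewrite divff //; apply: (is_integer_nat K 1).
    by rewrite xy => /(_ i); rewrite wE eqxx.
  have half : ~ is_integer (1%:R / 2%:R : K).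
    by rewrite mul1r; apply: not_integer_half.
  have := dvd c c' LE'; have := dvd c' c (esym LE').
  by case: (mult_or hc i) => ->; case: (mult_or hc' i) => ->.
have {cE} cE : c' = c by apply/funext => i; rewrite cE.
rewrite cE in dB.
have he f : f \in B -> height c f = 1.
  move=> /dB [i iE].
  rewrite /height (bigD1 i) //= iE eqxx big1 => [|j ij].
    by rewrite divff ?mult_neq0 // addr0.
  by rewrite iE eq_sym (negPf ij) mul0r.
rewrite -(ler_int K) (hgt_height hc hB dB hl).
have [m mE] := le.
have : 0 <= height c (e + h - l).
  rewrite mE height_sum big_seq sumr_ge0 // => b bp.
  rewrite heightMn mulr_ge0 //; have [k ->] := base_comb ha bp.
  rewrite height_sum sumr_ge0 // => i _.
  by rewrite heightMn mulr_ge0.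
rewrite heightD heightN heightD (he e) // (he h) // => hge.
by clear LE LE'; lra.
Qed.

End Admissible.

(** * The classical models *)

Section Coordinates.

Variables (K : realFieldType) (m : nat).
Implicit Types (x y : 'rV[K]_m).

(* Out of range indices are allowed and give [0]: then [unit_row i - unit_row
   i.+1] is the last simple root of type B when [i.+1 = m]. *)
Definition unit_row (k : nat) : 'rV[K]_m := \row_j (j == k :> nat)%:R.
Definition entry (k : nat) x : K := \sum_(j < m) x 0 j *+ (j == k :> nat).

Local Notation E := unit_row.
Local Notation X := entry.

Lemma entry_ord (j : 'I_m) x : X j x = x 0 j.
Proof.
rewrite /entry (bigD1 j) //= eqxx big1 ?addr0 // => i /negPf ij.
by rewrite (inj_eq val_inj) ij.
Qed.

Lemma entry_out k x : (m <= k)%N -> X k x = 0.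
Proof.
move=> mk; rewrite /entry big1 // => i _.
by rewrite ltn_eqF // (leq_trans (ltn_ord i)).
Qed.

Lemma entryD k x y : X k (x + y) = X k x + X k y.
Proof.
by rewrite /entry -big_split; apply: eq_bigr => i _; rewrite mxE mulrnDl.
Qed.

Lemma entryZ k t x : X k (t *: x) = t * X k x.
Proof.
by rewrite /entry mulr_sumr; apply: eq_bigr => i _; rewrite mxE mulrnAr.
Qed.

Lemma entryN k x : X k (- x) = - X k x.
Proof. by rewrite -scaleN1r entryZ mulN1r. Qed.

Lemma entryB k x y : X k (x - y) = X k x - X k y.
Proof. by rewrite entryD entryN. Qed.

Lemma entry0 k : X k 0 = 0.
Proof. by rewrite -(scale0r (0 : 'rV[K]_m)) entryZ mul0r. Qed.

Lemma entry_sum k I (r : seq I) (P : pred I) (F : I -> 'rV[K]_m) :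
  X k (\sum_(i <- r | P i) F i) = \sum_(i <- r | P i) X k (F i).
Proof. exact: (big_morph _ (entryD k) (entry0 k)). Qed.

Lemma entry_inj x y : (forall k, (k < m)%N -> X k x = X k y) -> x = y.
Proof. by move=> h; apply/rowP => j; rewrite -!entry_ord h. Qed.

Lemma unit_row_out k : (m <= k)%N -> E k = 0.
Proof.
move=> mk; apply/rowP => j; rewrite !mxE ltn_eqF //.
by rewrite (leq_trans (ltn_ord j)).
Qed.

Lemma unit_row_ord (j : 'I_m) : E j = delta_mx 0 j.
Proof. by apply/rowP => i; rewrite !mxE. Qed.

Lemma entry_unit i j : X i (E j) = ((i == j) && (j < m)%N)%:R.
Proof.
have [im|mi] := ltnP i m; last first.
  rewrite entry_out //; case: eqP => [<-|] //=.
  by rewrite ltnNge mi.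
rewrite -[i]/(val (Ordinal im)) entry_ord mxE /=.
by case: eqP => [<-|] //; rewrite im.
Qed.

Lemma row_entries x : x = \sum_(j < m) X j x *: E j.
Proof.
apply: entry_inj => k km; rewrite entry_sum (bigD1 (Ordinal km)) //= big1.
  by rewrite entryZ entry_unit eqxx km mulr1 addr0.
move=> j jk; rewrite entryZ entry_unit; case: eqP => [kj|]; last by rewrite mulr0.
by case/eqP: jk; apply/val_inj.
Qed.

(** The reflection in [E k - E k.+1]. At [k.+1 = m] this vector is [E k], of half the squared norm,
    which gives the factor 2 and makes the reflection a change of sign. *)
Definition row_refl (k : nat) x : 'rV[K]_m :=
  x - ((if (k.+1 < m)%N then 1 else 2) * (X k x - X k.+1 x)) *: (E k - E k.+1).

Lemma row_reflD k x y : row_refl k (x + y) = row_refl k x + row_refl k y.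
Proof.
rewrite /row_refl !entryD addrACA -opprD -scalerDl.
by congr (_ - _ *: _); ring.
Qed.

Lemma row_reflZ k t x : row_refl k (t *: x) = t *: row_refl k x.
Proof.
rewrite /row_refl !entryZ [RHS]scalerBr scalerA.
by congr (_ - _ *: _); ring.
Qed.

Lemma row_reflN k x : row_refl k (- x) = - row_refl k x.
Proof. by rewrite -scaleN1r row_reflZ scaleN1r. Qed.

Definition swap (k j : nat) : nat :=
  if j == k then k.+1 else if j == k.+1 then k else j.

Lemma swap_lt k j : (k.+1 < m)%N -> (j < m)%N -> (swap k j < m)%N.
Proof. by rewrite /swap; have [?|?] := eqVneq j k; have [?|?] := eqVneq j k.+1; lia. Qed.

Lemma swap_inj k : injective (swap k).
Proof.
move=> i j; rewrite /swap.
have [?|?] := eqVneq i k; have [?|?] := eqVneq j k;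
  have [?|?] := eqVneq i k.+1; have [?|?] := eqVneq j k.+1; lia.
Qed.

Lemma row_refl_swap k j : (k.+1 < m)%N -> row_refl k (E j) = E (swap k j).
Proof.
move=> km; rewrite /row_refl km mul1r !entry_unit /swap.
have [->|jk] := eqVneq j k.
  rewrite (ltnW km) gtn_eqF //= subr0 scale1r opprB addrC subrK.
  by [].
have [->|jk1] := eqVneq j k.+1.
  by rewrite km /= sub0r scaleN1r opprK addrC subrK.
by rewrite /= subrr scale0r subr0.
Qed.

Lemma row_refl_flip k j : k.+1 = m -> row_refl k (E j) = (-1) ^+ (j == k) *: E j.
Proof.
move=> km; rewrite /row_refl km ltnn (unit_row_out (leqnn m)) subr0.
rewrite (entry_out _ (leqnn m)) subr0 entry_unit.
have [->|jk] := eqVneq j k.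
  have -> : (k < m)%N by rewrite -km.
  by rewrite mulr1 expr1 scaleN1r scaler_nat mulr2n opprD addrA subrr add0r.
by rewrite mulr0 scale0r subr0 expr0 scale1r.
Qed.

Lemma differencesP x : @differences K m x <-> exists i j,
  [/\ (i < m)%N, (j < m)%N, i != j & x = E i - E j].
Proof.
split=> [[i [j [ij ->]]]|[i [j [im jm ij ->]]]].
  by exists i, j; rewrite !unit_row_ord.
exists (Ordinal im), (Ordinal jm); split; first by [].
by rewrite -!unit_row_ord.
Qed.

Lemma sums_and_differencesP x : @sums_and_differences K m x <->
  exists i j (s t : bool), [/\ (i < m)%N, (j < m)%N, i != j
    & x = (-1) ^+ s *: E i + (-1) ^+ t *: E j].
Proof.
split=> [[i [j [s [t [ij ->]]]]]|[i [j [s [t [im jm ij ->]]]]]].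
  by exists i, j, s, t; rewrite !unit_row_ord.
exists (Ordinal im), (Ordinal jm), s, t; split; first by [].
by rewrite -!unit_row_ord.
Qed.

Lemma axis_vectorsP k x : @axis_vectors K m k x <->
  exists i (s : bool), (i < m)%N /\ x = ((-1) ^+ s * k) *: E i.
Proof.
split=> [[i [s ->]]|[i [s [im ->]]]]; first by exists i, s; rewrite unit_row_ord.
by exists (Ordinal im), s; rewrite -unit_row_ord.
Qed.

(** One family for types B, C and BC, which differ only in the lengths [ks] allowed along the
    axes. *)
Definition signed_roots (ks : seq K) : set 'rV[K]_m :=
  [set x | sums_and_differences x \/ exists2 k, k \in ks & axis_vectors k x]%classic.

Lemma rootsB_signed : @rootsB K m = signed_roots [:: 1].
Proof.
apply/seteqP; split=> x [h|h]; [by left | | by left |].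
  by right; exists 1; rewrite ?inE.
by case: h => k; rewrite inE => /eqP -> h; right.
Qed.

Lemma rootsC_signed : @rootsC K m = signed_roots [:: 2].
Proof.
apply/seteqP; split=> x [h|h]; [by left | | by left |].
  by right; exists 2; rewrite ?inE.
by case: h => k; rewrite inE => /eqP -> h; right.
Qed.

Lemma rootsBC_signed : @rootsBC K m = signed_roots [:: 1; 2].
Proof.
rewrite /rootsBC rootsB_signed rootsC_signed; apply/seteqP; split=> x.
  by case=> [] [h|[k]]; [by left| |by left|]; rewrite inE => /eqP -> h; right;
    [exists 1 | exists 2]; rewrite // !inE eqxx ?orbT.
case=> [h|[k]]; first by left; left.
rewrite !inE => /orP [] /eqP -> h; [left | right]; right.
  by exists 1; rewrite ?inE.
by exists 2; rewrite ?inE.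
Qed.

Lemma differencesN x : @differences K m x -> differences (- x).
Proof.
move=> /differencesP [i [j [im jm ij ->]]]; apply/differencesP.
by exists j, i; rewrite opprB eq_sym.
Qed.

Lemma signed_rootsN ks x : signed_roots ks x -> signed_roots ks (- x).
Proof.
case=> [/sums_and_differencesP [i [j [s [t [im jm ij ->]]]]]|[k kk]].
  left; apply/sums_and_differencesP; exists i, j, (~~ s), (~~ t).
  by rewrite !signrN !scaleNr -opprD.
move=> /axis_vectorsP [i [s [im ->]]]; right; exists k => //.
by apply/axis_vectorsP; exists i, (~~ s); rewrite signrN mulNr scaleNr.
Qed.

Lemma differences_refl k x :
  (k.+1 < m)%N -> @differences K m x -> differences (row_refl k x).
Proof.
move=> km /differencesP [i [j [im jm ij ->]]]; apply/differencesP.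
exists (swap k i), (swap k j); rewrite !swap_lt // (inj_eq (@swap_inj k)).
by rewrite row_reflD row_reflN !row_refl_swap.
Qed.

Lemma signed_roots_refl ks k x :
  (k < m)%N -> signed_roots ks x -> signed_roots ks (row_refl k x).
Proof.
rewrite leq_eqVlt => /predU1P [km|km].
  case=> [/sums_and_differencesP [i [j [s [t [im jm ij ->]]]]]|[z zk]].
    left; apply/sums_and_differencesP.
    exists i, j, (s (+) (i == k)), (t (+) (j == k)); split=> //.
    by rewrite row_reflD !row_reflZ !row_refl_flip // !scalerA !signr_addb.
  move=> /axis_vectorsP [i [s [im ->]]]; right; exists z => //.
  apply/axis_vectorsP; exists i, (s (+) (i == k)); split=> //.
  by rewrite row_reflZ row_refl_flip // scalerA signr_addb mulrAC.
case=> [/sums_and_differencesP [i [j [s [t [im jm ij ->]]]]]|[z zk]].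
  left; apply/sums_and_differencesP.
  exists (swap k i), (swap k j), s, t.
  rewrite !swap_lt // (inj_eq (@swap_inj k)); split=> //.
  by rewrite row_reflD !row_reflZ !row_refl_swap.
move=> /axis_vectorsP [i [s [im ->]]]; right; exists z => //.
apply/axis_vectorsP; exists (swap k i), s; rewrite swap_lt //; split=> //.
by rewrite row_reflZ row_refl_swap.
Qed.

Section Generation.

Variable S : set 'rV[K]_m.
Hypothesis SN : forall x, S x -> S (- x).

(** Induction on the distance between the two indices: each reflection moves the second index one
    step away. It is applied with [S] the image of the roots. *)
Lemma gen_differences :
  (forall k x, (k.+1 < m)%N -> S x -> S (row_refl k x)) ->
  (forall k, (k.+1 < m)%N -> S (E k - E k.+1)) ->
  subset (@differences K m) S.
Proof.
move=> Srefl Sg.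
have lt i d : (i + d.+1 < m)%N -> S (E i - E (i + d.+1)).
  elim: d => [|d ih] im; first by rewrite addn1 in im *; apply: Sg.
  rewrite addnS in im *; have := Srefl (i + d.+1)%N _ im (ih (ltnW im)).
  rewrite row_reflD row_reflN !row_refl_swap // /swap eqxx.
  by rewrite !ltn_eqF //; lia.
move=> x /differencesP [i [j [im jm ij ->]]].
have [ji|ji] := ltnP i j.
  by have := lt i (j - i).-1; rewrite prednK ?subn_gt0 // subnKC ?(ltnW ji) //; apply.
have {ij}ji : (j < i)%N by rewrite ltn_neqAle eq_sym ij.
rewrite -opprB; apply: SN.
by have := lt j (i - j).-1; rewrite prednK ?subn_gt0 // subnKC ?(ltnW ji) //; apply.
Qed.

(** Swaps carry the last axis vector to every axis. The sign change of the last coordinate turns a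
    difference into a sum, and swaps then move its second index down. *)
Lemma gen_signed_roots ks :
  (forall k x, (k < m)%N -> S x -> S (row_refl k x)) ->
  (forall k, (k.+1 < m)%N -> S (E k - E k.+1)) ->
  (forall k, k \in ks -> S (k *: E m.-1)) ->
  subset (signed_roots ks) S.
Proof.
move=> Srefl Sg Sk.
have Sdiff : subset (@differences K m) S.
  by apply: gen_differences => // k x km; apply: Srefl; apply: ltnW.
have axis k i d : k \in ks -> (i + d = m.-1)%N -> (i < m)%N -> S (k *: E i).
  move=> kk; elim: d i => [|d ih] i; first by rewrite addn0 => -> _; apply: Sk.
  move=> id im; have i1m : (i.+1 < m)%N by lia.
  have := Srefl i _ im (ih i.+1 _ i1m); rewrite addSnnS => /(_ id).
  by rewrite row_reflZ row_refl_swap // /swap eqxx gtn_eqF.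
have sum i j d : (i < j)%N -> (j + d = m.-1)%N -> (j < m)%N -> S (E i + E j).
  elim: d j => [|d ih] j ij jd jm.
    have := Srefl j (E i - E j) jm.
    rewrite row_reflD row_reflN !row_refl_flip; [|lia|lia].
    rewrite eqxx ltn_eqF // expr0 expr1 scale1r scaleN1r opprK; apply.
    apply: Sdiff; apply/differencesP; exists i, j; rewrite ltn_eqF //.
    by rewrite (ltn_trans ij).
  have j1m : (j.+1 < m)%N by lia.
  have := Srefl j _ jm (ih j.+1 (ltnW ij) _ j1m); rewrite addSnnS => /(_ jd).
  rewrite row_reflD !row_refl_swap // /swap eqxx.
  rewrite (ltn_eqF ij) (ltn_eqF (ltnW ij : i < j.+1)%N) (_ : j.+1 == j = false) //.
  by apply/eqP; lia.
have sgn (b : bool) x : S x -> S ((-1) ^+ b *: x).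
  by case: b => Sx; rewrite ?expr0 ?expr1 ?scale1r ?scaleN1r //; apply: SN.
have Ssum i j : (i < m)%N -> (j < m)%N -> i != j -> S (E i + E j).
  move=> im jm; rewrite neq_ltn => /orP [ij|ij].
    by apply: (sum i j (m.-1 - j)%N) => //; lia.
  by rewrite addrC; apply: (sum j i (m.-1 - i)%N) => //; lia.
move=> x [/sums_and_differencesP [i [j [s [t [im jm ij ->]]]]]|[k kk]]; last first.
  move=> /axis_vectorsP [i [s [im ->]]]; rewrite -scalerA; apply: sgn.
  by apply: (axis _ _ (m.-1 - i)%N) => //; lia.
(* Up to a global sign only the relative sign matters, which leaves one sum or one difference. *)
have -> : (-1) ^+ s *: E i + (-1) ^+ t *: E j =
    (-1) ^+ s *: (E i + (-1) ^+ (s (+) t) *: E j).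
  by rewrite scalerDr scalerA -signr_addb addKb.
apply: sgn; case: (s (+) t); rewrite ?expr0 ?expr1 ?scale1r ?scaleN1r.
  by apply: Sdiff; apply/differencesP; exists i, j.
exact: Ssum.
Qed.

End Generation.

End Coordinates.

Section FrameMap.

Variables (K : realFieldType) (V : vectType K) (n m : nat).
Variables (X : n.-tuple V) (g : 'I_n -> 'rV[K]_m).

Definition basis_map (v : V) : 'rV[K]_m := \sum_i coord X i v *: g i.

Lemma basis_map_is_linear : linear basis_map.
Proof.
move=> k u v; rewrite /basis_map scaler_sumr -big_split; apply: eq_bigr => i _.
by rewrite /= linearP scalerDl scalerA.
Qed.

HB.instance Definition _ :=
  GRing.isLinear.Build K V 'rV[K]_m _ basis_map basis_map_is_linear.

End FrameMap.

(** * Coordinates adapted to a base *)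

Section Frames.

Variables (K : realFieldType) (V : vectType K) (form : {dot V for idfun}).
Variables (R Rp : {fset V}).
Hypotheses (hR : root_system form R) (hP : positive_roots R Rp).
Local Notation pairing := (pairing form).
Local Notation refl := (reflection form).
Local Notation E := (unit_row K _).
Local Notation X := entry.

(* [f] identifies [a i] with [d i] times [e_i - e_(i+1)] (with [e_m = 0]) and
   its coroot with the functional [c i] times [x_i - x_(i+1)]. *)
Record frame n m (a : 'I_n -> V) (c d : 'I_n -> K) (f : 'Hom(V, 'rV[K]_m)) : Prop :=
  Frame {
    frame_base : forall i, f (a i) = d i *: (E i - E i.+1);
    frame_pairing : forall v i, pairing v (a i) = c i * (X i (f v) - X i.+1 (f v));
    frame_norm : forall i : 'I_n, c i * d i = if (i.+1 < m)%N then 1 else 2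
  }.

Section Base.

Variables (n : nat) (a : 'I_n -> V).
Hypothesis ha : is_base Rp a.

(** The formula for a coroot is linear in the vector, so it suffices to compare Cartan entries on
    the base. *)
Lemma frame_exists m c d :
  (forall i : 'I_n, c i * d i = if (i.+1 < m)%N then 1 else 2) ->
  (forall i j, pairing (a j) (a i) =
     c i * (d j * (X i (E j - E j.+1 : 'rV_m) - X i.+1 (E j - E j.+1 : 'rV_m)))) ->
  exists f : 'Hom(V, 'rV[K]_m), frame a c d f.
Proof.
move=> hn hc; pose t := [tuple a i | i < n].
have ft : free t.
  apply/freeP => k k0 i; apply: (base_free ha) => //; rewrite -[RHS]k0.
  by apply: eq_bigr => j _; rewrite -tnth_nth tnth_mktuple.
pose g i : 'rV[K]_m := d i *: (E i - E i.+1).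
pose f : 'Hom(V, 'rV[K]_m) := linfun (basis_map t g).
have fa i : f (a i) = g i.
  rewrite lfunE /= /basis_map (bigD1 i) //=.
  have co j : coord t j (a i) = (j == i)%:R.
    by rewrite -(tnth_mktuple a i) (tnth_nth 0) coord_free // eq_sym.
  rewrite co eqxx scale1r big1 ?addr0 // => j /negPf ji.
  by rewrite co ji scale0r.
exists f; split=> // v i.
have [x ->] := base_span hR hP ha v.
rewrite linear_sum !entry_sum pairing_suml -sumrB mulr_sumr.
apply: eq_bigr => j _; rewrite linearZ /= fa pairingZl hc /g !entryZ.
by ring.
Qed.

End Base.

Section Iso.

Variables (n m : nat) (a : 'I_n -> V) (c d : 'I_n -> K) (f : 'Hom(V, 'rV[K]_m)).
Hypotheses (ha : is_base Rp a) (hf : frame a c d f).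

Lemma frame_inj : injective f.
Proof.
move=> u v e; apply: (pairing_base_inj hR hP ha) => i.
by rewrite !(frame_pairing hf) e.
Qed.

Lemma frame_refl i v : f (refl (a i) v) = row_refl i (f v).
Proof.
rewrite /reflection /row_refl linearB linearZ /= (frame_base hf) (frame_pairing hf).
by rewrite scalerA mulrAC (frame_norm hf).
Qed.

(** Stability of [M] under simple reflections gives one inclusion, by induction on the roots; [sub]
    is where the generation lemmas for the models enter. *)
Lemma frame_image (M : set 'rV[K]_m) :
  (forall x, M x -> M (- x)) ->
  (forall (i : 'I_n) x, M x -> M (row_refl i x)) ->
  (forall i, M (f (a i))) -> (forall i, 2 *: a i \in R -> M (f (2 *: a i))) ->
  subset M [set f v | v in [set` R]]%classic ->
  [set f v | v in [set` R]]%classic = M.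
Proof.
move=> MN Mr Ma M2 sub.
apply/seteqP; split=> // x [b /= bR <-].
move: b bR; apply: (base_ind_root hR hP ha) => // [b|i b bR Mb].
  by rewrite linearN; apply: MN.
by rewrite frame_refl; apply: Mr.
Qed.

Lemma frame_imageN x :
  [set f v | v in [set` R]]%classic x -> [set f v | v in [set` R]]%classic (- x).
Proof.
move=> [b /= bR <-]; exists (- b); last by rewrite linearN.
exact: (root_opp hR).
Qed.

Lemma frame_image_refl (i : 'I_n) x :
  [set f v | v in [set` R]]%classic x ->
  [set f v | v in [set` R]]%classic (row_refl i x).
Proof.
move=> [b /= bR <-]; exists (refl (a i) b); last exact: frame_refl.
exact/(refl_root hR)/bR/(base_root hP ha).
Qed.

End Iso.

Lemma frame_differences n (a : 'I_n -> V) (f : 'Hom(V, 'rV[K]_n.+1)) :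
  is_base Rp a -> frame a (fun=> 1) (fun=> 1) f ->
  (forall i, 2 *: a i \notin R) ->
  [set f v | v in [set` R]]%classic = @differences K n.+1.
Proof.
move=> ha hf no2; apply: (frame_image ha hf).
- exact: differencesN.
- by move=> i x; apply: differences_refl; rewrite ltnS.
- move=> i; rewrite (frame_base hf) scale1r; apply/differencesP.
  by exists i, i.+1; rewrite !ltnS ltn_eqF // ltnW.
- by move=> i; rewrite (negPf (no2 i)).
apply: gen_differences; first exact: frame_imageN.
  by move=> k x km; apply: (frame_image_refl ha hf (Ordinal (km : k < n)%N)).
move=> k km; exists (a (Ordinal (km : k < n)%N)); first exact: base_root ha _.
by rewrite (frame_base hf) scale1r.
Qed.

(** The scalings of the simple roots when the last one is [t] times a unit vector: [t = 1] for B and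
    BC, [t = 2] for C. *)
Definition last_scale n (t : K) (i : 'I_n.+1) : K := if (i < n)%N then 1 else t.

Lemma frame_signed_roots n (a : 'I_n.+1 -> V) (t : K) ks (f : 'Hom(V, 'rV[K]_n.+1)) c :
  is_base Rp a -> frame a c (last_scale t) f -> t \in ks ->
  (forall i, 2 *: a i \in R -> i = ord_max /\ 2 * t \in ks) ->
  (forall k, k \in ks -> k = t \/ k = 2 * t /\ 2 *: a ord_max \in R) ->
  [set f v | v in [set` R]]%classic = @signed_roots K n.+1 ks.
Proof.
move=> ha hf tk h2 hk.
have flast : f (a ord_max) = t *: E n.
  by rewrite (frame_base hf) /last_scale ltnn (unit_row_out _ (leqnn n.+1)) subr0.
have axis k : k \in ks -> signed_roots ks (k *: E n : 'rV_n.+1).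
  move=> kk; right; exists k => //; apply/axis_vectorsP; exists n, false.
  by rewrite expr0 mul1r.
apply: (frame_image ha hf).
- exact: signed_rootsN.
- by move=> i x; apply: signed_roots_refl.
- move=> i; have [im|mi] := ltnP i n; last first.
    rewrite (_ : i = ord_max) ?flast; first exact: axis.
    by apply/val_inj/eqP; rewrite /= eqn_leq mi -ltnS ltn_ord.
  rewrite (frame_base hf) /last_scale im scale1r; left.
  apply/sums_and_differencesP; exists i, i.+1, false, true.
  by rewrite expr0 expr1 scale1r scaleN1r ltn_eqF // ltnS im ltnW.
- move=> i i2; have [-> tk2] := h2 i i2.
  by rewrite linearZ /= flast scalerA; apply: axis.
have aR := base_root hP ha.
apply: gen_signed_roots; first exact: frame_imageN.
- by move=> k x km; apply: (frame_image_refl ha hf (Ordinal km)).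
- move=> k km; exists (a (Ordinal (ltnW km))); first exact: aR.
  by rewrite (frame_base hf) /last_scale /= (km : k < n)%N scale1r.
move=> k /hk [->|[-> r2]]; rewrite /= .
  by exists (a ord_max); [exact: aR | exact: flast].
by exists (2 *: a ord_max) => //; rewrite linearZ /= flast scalerA.
Qed.

End Frames.

(** * The Dynkin diagram is a path *)

Section Connected.

Variables (K : realFieldType) (V : vectType K) (form : {dot V for idfun}).
Variables (R Rp : {fset V}).
Hypotheses (hR : root_system form R) (hP : positive_roots R Rp).
Variables (n : nat) (a : 'I_n -> V).
Hypothesis ha : is_base Rp a.
Local Notation pairing := (pairing form).
Local Notation refl := (reflection form).
Let aR := base_root hP ha.
Let a0 := base_neq0 hR hP ha.

Lemma pairing_eq0_sym u v :
  u != 0 -> v != 0 -> (pairing u v == 0) = (pairing v u == 0).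
Proof. by move=> u0 v0; rewrite !pairing_eq0 // form_sym. Qed.

(** If no edge leaves [S], the spans of [S] and of its complement are orthogonal, and simple
    reflections preserve both. Hence every root lies in one of them, and the roots split. *)
Lemma irreducible_connected (S : pred 'I_n) :
  irreducible_roots form R -> (exists i, S i) ->
  (forall i j, S i -> ~~ S j -> pairing (a i) (a j) = 0) -> forall i, S i.
Proof.
move=> [_ irr] [i0 Si0] hS.
pose sup (T : pred 'I_n) v :=
  exists x : 'I_n -> K, (forall i, ~~ T i -> x i = 0) /\ v = \sum_i x i *: a i.
have supN T v : sup T v -> sup T (- v).
  move=> [x [x0 ->]]; exists (fun i => - x i); split=> [i /x0 ->|].
    by rewrite oppr0.
  by rewrite -sumrN; apply: eq_bigr => i _; rewrite scaleNr.
have supZ (T : pred 'I_n) i t : T i -> sup T (t *: a i).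
  move=> Ti; exists (fun j => if j == i then t else 0); split=> [j|].
    by case: eqP => // -> /negP.
  rewrite (bigD1 i) //= eqxx big1 ?addr0 // => j /negPf ->.
  by rewrite scale0r.
have supD (T : pred 'I_n) u v : sup T u -> sup T v -> sup T (u + v).
  move=> [x [x0 ->]] [y [y0 ->]]; exists (fun i => x i + y i); split=> [i h|].
    by rewrite x0 // y0 // addr0.
  by rewrite -big_split; apply: eq_bigr => i _; rewrite scalerDl.
have perp u v : sup S u -> sup (predC S) v -> form u v = 0.
  move=> [x [x0 ->]] [y [y0 ->]].
  rewrite form_suml big1 // => i _; rewrite form_sumr big1 // => j _.
  rewrite formZl formZr.
  have [Si|Si] := boolP (S i); last by rewrite x0 // mul0r.
  have [Sj|Sj] := boolP (S j); first by rewrite y0 ?mul0r ?mulr0 //= Sj.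
  have /eqP := hS i j Si Sj; rewrite pairing_eq0 // => /eqP ->.
  by rewrite !mulr0.
have refl_sup (T : pred 'I_n) : (forall i j, T i -> ~~ T j -> pairing (a i) (a j) = 0) ->
    forall i b, sup T b -> sup T (refl (a i) b).
  move=> hT i b bT; apply: supD => //; apply: supN.
  have [Ti|Ti] := boolP (T i); first exact: supZ.
  have [x [x0 ->]] := bT.
  rewrite pairing_suml big1 ?scale0r => [|j _]; last first.
    rewrite pairingZl; have [Tj|Tj] := boolP (T j); first by rewrite hT ?mulr0.
    by rewrite x0 ?mul0r.
  by exists (fun=> 0); split=> //; rewrite big1 // => j _; rewrite scale0r.
have dich b : b \in R -> sup S b \/ sup (predC S) b.
  move: b; apply: (base_ind_root hR hP ha) => [b|i|i _|i b bR].
  - by case=> /supN; [left | right].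
  - by rewrite -[a i]scale1r; case: (boolP (S i)) => Si; [left | right]; apply: supZ.
  - by case: (boolP (S i)) => Si; [left | right]; apply: supZ.
  case=> h; [left | right]; apply: refl_sup => //.
  move=> j l /= nSj; rewrite negbK => Sl; apply/eqP.
  by rewrite pairing_eq0_sym // hS.
pose RS := [fset b in R | `[< sup S b >]]%fset.
pose RC := [fset b in R | `[< sup (predC S) b >]]%fset.
have RE : R = (RS `|` RC)%fset.
  apply/fsetP => b; rewrite !inE /=; case: (boolP (b \in R)) => //= bR.
  by case: (dich b bR) => h; apply/esym/orP; [left | right]; apply/asboolP.
move=> i; apply/negPn/negP => nSi.
have [s t|e|e] := irr RS RC RE.
- by rewrite !inE /= => /andP [_ /asboolP hs] /andP [_ /asboolP ht]; apply: perp.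
- have : a i0 \in RS.
    by rewrite !inE /= aR; apply/asboolP; rewrite -[a i0]scale1r; apply: supZ.
  by rewrite e inE.
have : a i \in RC.
  by rewrite !inE /= aR; apply/asboolP; rewrite -[a i]scale1r; apply: supZ.
by rewrite e inE.
Qed.

Lemma base_reindex k (s : 'I_k -> 'I_n) : bijective s -> is_base Rp (a \o s).
Proof.
move=> bs; split=> [i|x x0 i|b bp].
- exact: base_pos ha _.
- have [t st ts] := bs.
  have := base_free ha (x := x \o t) _ (s i); rewrite /= st; apply.
  rewrite (reindex s) /=; last exact: onW_bij.
  by rewrite -[RHS]x0; apply: eq_bigr => j _; rewrite st.
have [m ->] := base_comb ha bp; exists (m \o s).
by rewrite (reindex s) /=; last exact: onW_bij.
Qed.

(** * Growing a path from a vertex of positive column sum *)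

Section Walk.

Variable c : 'I_n -> nat.
Hypothesis hc : multipliers form R a c.
Hypothesis hh : forall j, 0 <= height form a c (a j).

(** For [i != j] a natural number, positive exactly on edges; the column sum is
    [height (a j) = 2 / c_j] minus the [N i j] with [i != j]. *)
Local Notation N i j := (- (pairing (a j) (a i) / (c i)%:R)).

Let cn i : (c i)%:R != 0 :> K := mult_neq0 hc i.

Lemma N_ge0 i j : i != j -> 0 <= N i j.
Proof.
move=> ij; rewrite -mulNr divr_ge0 // oppr_ge0.
by apply: (pairing_base_le0 hR hP ha); rewrite eq_sym.
Qed.

Lemma N_ge1 i j : i != j -> pairing (a j) (a i) != 0 -> 1 <= N i j.
Proof.
move=> ij nz; apply: is_integer_gt0.
  exact/is_integerN/(mult_int hc).
by rewrite lt_def N_ge0 // andbT oppr_eq0 mulf_neq0 // invr_eq0.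
Qed.

Lemma N_eq0 i j : i != j -> N i j < 1 -> pairing (a j) (a i) = 0.
Proof.
move=> ij h; apply/eqP/negP => /negP /(N_ge1 ij).
by rewrite leNgt h.
Qed.

(** The terms outside [s] and [j] contribute with a favourable sign and are dropped. *)
Lemma column_bound (s : seq 'I_n) j : uniq s -> j \notin s ->
  height form a c (a j) + \sum_(i <- s) N i j <= 2 / (c j)%:R.
Proof.
move=> us js; rewrite /height (bigD1 j) //= pairing_self //.
rewrite -[leRHS]addr0 -addrA lerD2l -lerBrDr sub0r -sumrN.
rewrite (big_uniq _ us) /= big_mkcond [leRHS]big_mkcond /=.
apply: ler_sum => i _; rewrite opprK.
have [->|ij] := eqVneq i j; first by rewrite (negPf js).
case: (i \in s) => //=.
by rewrite -oppr_ge0 N_ge0.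
Qed.

(** The height is 1 on a scaled fundamental weight, so it cannot vanish on all simple roots, which
    span; on them it is integral and nonnegative. *)
Lemma height_pos_exists : (0 < n)%N -> exists j, 1 <= height form a c (a j).
Proof.
move=> n0; have [w wE] := base_dual_vectors hR hP ha c.
pose i := Ordinal n0; have [x xE] := base_span hR hP ha (w i).
have hw : height form a c (w i) = 1.
  rewrite /height (bigD1 i) //= wE eqxx divff // big1 ?addr0 // => j ji.
  by rewrite wE eq_sym (negPf ji) mul0r.
have [j hj] : exists j, height form a c (a j) != 0.
  apply: contrapT => /forallNP h; move: hw.
  rewrite xE height_sum big1 => [/esym/eqP|j _]; first by rewrite oner_eq0.
  by rewrite heightZ; have /negP := h j; rewrite negbK => /eqP ->; rewrite mulr0.
exists j; apply: is_integer_gt0; last by rewrite lt_def hj hh.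
by apply: is_integer_sum => i'; apply: (mult_int hc).
Qed.

(** The part of the path found so far. Everything about a vertex before [p k] is settled, its
    neighbours included, while the last vertex is still open. The positive height at the start
    stands in for the missing predecessor. *)
Record chain (k : nat) (p : nat -> 'I_n) : Prop := Chain {
  chain_start : 1 <= height form a c (a (p 0%N));
  chain_inj : forall s t, (s <= k)%N -> (t <= k)%N -> p s = p t -> s = t;
  chain_one : forall t, (t < k)%N -> c (p t) = 1%N;
  chain_next : forall t, (t < k)%N -> N (p t.+1) (p t) = 1;
  chain_prev : forall t, (t.+1 < k)%N -> N (p t) (p t.+1) = 1;
  chain_zero : forall t z, (t < k)%N -> z != p t -> z != p t.+1 ->
    ((0 < t)%N -> z != p t.-1) -> pairing (a (p t)) (a z) = 0
}.

Lemma chain_prev_ge1 k p : chain k.+1 p -> 1 <= N (p k) (p k.+1).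
Proof.
move=> hp.
have ne : p k.+1 != p k.
  by apply/eqP => /(chain_inj hp); rewrite !leqnn leqnSn => /(_ isT isT); lia.
apply: N_ge1; first by rewrite eq_sym.
rewrite pairing_eq0_sym //.
have := chain_next hp (ltnSn k).
by apply: contra_eq_neq => ->; rewrite mul0r oppr0 eq_sym oner_eq0.
Qed.

Lemma two_div_c j : 2 / (c j)%:R <= 2 :> K.
Proof.
by case: (mult_or hc j) => ->; lra.
Qed.

Lemma c_one j : 1 < 2 / (c j)%:R :> K -> c j = 1%N.
Proof. by case: (mult_or hc j) => -> // h; exfalso; lra. Qed.

(* The column sum at the last vertex leaves room for exactly two units besides
   the diagonal: at the first vertex the positive column sum takes one of them,
   at a later one the previous vertex does. *)
Lemma chain_extend k p y : chain k p -> (forall t, (t <= k)%N -> p t != y) ->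
  pairing (a (p k)) (a y) != 0 ->
  chain k.+1 (fun t => if t == k.+1 then y else p t).
Proof.
move=> hp yn adj.
have yk : y != p k by rewrite eq_sym yn.
have N1 := N_ge1 yk adj.
have c2 := two_div_c (p k).
have [prev1 c1 Ny Nz] : [/\ (0 < k)%N -> N (p k.-1) (p k) = 1, c (p k) = 1%N,
    N y (p k) = 1 & forall z, z != p k -> z != y -> ((0 < k)%N -> z != p k.-1) ->
    pairing (a (p k)) (a z) = 0].
  case: k => [|k] in hp yn adj yk N1 c2 *.
    have h1 := chain_start hp.
    have := @column_bound [:: y] (p 0%N) isT; rewrite inE eq_sym => /(_ yk).
    rewrite big_seq1 => b1; split=> //.
    - by apply: c_one; lra.
    - by lra.
    move=> z zk zy _; apply: (N_eq0 zk).
    have u2 : uniq [:: z; y] by rewrite /= inE zy.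
    have n2 : p 0%N \notin [:: z; y] by rewrite !inE !(eq_sym (p 0%N)) negb_or zk yk.
    have := column_bound u2 n2; rewrite big_cons big_seq1 => b2.
    have := N_ge0 zk.
    by lra.
  have Np := chain_prev_ge1 hp; rewrite /=.
  have pk : p k != p k.+1.
    by apply/eqP => /(chain_inj hp); rewrite !leqnn leqnSn => /(_ isT isT); lia.
  have py : p k != y by apply: yn.
  have hk := hh (p k.+1).
  have u2 : uniq [:: y; p k] by rewrite /= inE eq_sym py.
  have n2 : p k.+1 \notin [:: y; p k].
    by rewrite !inE !(eq_sym (p k.+1)) negb_or yk pk.
  have := column_bound u2 n2; rewrite big_cons big_seq1 => b1; split.
  - by move=> _; lra.
  - by apply: c_one; lra.
  - by lra.
  move=> z zk zy /(_ isT) zp; apply: (N_eq0 zk).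
  have u3 : uniq (z :: [:: y; p k]) by rewrite cons_uniq u2 !inE negb_or zy zp.
  have n3 : p k.+1 \notin z :: [:: y; p k].
    by rewrite inE negb_or n2 eq_sym zk.
  have := column_bound u3 n3; rewrite !big_cons big_nil => b2.
  by lra.
split=> //=.
- exact: chain_start hp.
- move=> s t; rewrite leq_eqVlt ltnS => /predU1P [->|sk];
    rewrite leq_eqVlt ltnS => /predU1P [->|tk] //.
  + rewrite eqxx (@ltn_eqF t) ?ltnS // => e.
    by have := yn t tk; rewrite e eqxx.
  + rewrite eqxx (@ltn_eqF s) ?ltnS // => e.
    by have := yn s sk; rewrite e eqxx.
  by rewrite !ltn_eqF //; apply: (chain_inj hp).
- move=> t; rewrite ltnS leq_eqVlt => /predU1P [->|tk]; rewrite ltn_eqF //.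
    exact: chain_one hp _ tk.
  exact: ltnW.
- move=> t; rewrite ltnS leq_eqVlt => /predU1P [->|tk]; first by rewrite eqxx ltn_eqF.
  by rewrite eqSS !ltn_eqF ?(chain_next hp) // ltnW.
- move=> t; rewrite !eqSS ltnS leq_eqVlt => /predU1P [tk|tk].
    rewrite -tk in prev1 *; rewrite (@ltn_eqF t t.+2) // (@ltn_eqF t t.+1) //.
    exact: prev1.
  by rewrite !ltn_eqF ?(chain_prev hp) // ltnW // ltnW.
move=> t z; rewrite ltnS leq_eqVlt => /predU1P [->|tk].
  rewrite eqxx ltn_eqF // => zk zy zp; apply: Nz => // k0.
  by have := zp k0; rewrite ltn_eqF // ltnS leq_pred.
rewrite eqSS !ltn_eqF //; [|lia|lia] => h1 h2 h3; apply: (chain_zero hp) => //.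
Qed.

End Walk.

End Connected.

Section Path.

Variables (K : realFieldType) (V : vectType K) (form : {dot V for idfun}).
Variables (R Rp : {fset V}).
Hypotheses (hR : root_system form R) (hP : positive_roots R Rp).
Hypothesis hirr : irreducible_roots form R.
Local Notation pairing := (pairing form).

(* The Dynkin diagram is the path [b 0 - b 1 - ... - b k]. *)
Record dynkin_path k (b : 'I_k.+1 -> V) (e : 'I_k.+1 -> nat) : Prop := DynkinPath {
  path_one : forall i : 'I_k.+1, (i < k)%N -> e i = 1%N;
  path_next : forall i j : 'I_k.+1, j = i.+1 :> nat -> pairing (b i) (b j) = - (e j)%:R;
  path_prev : forall i j : 'I_k.+1, j = i.+1 :> nat -> (j < k)%N ->
    pairing (b j) (b i) = -1;
  path_far : forall i j : 'I_k.+1, i != j -> j <> i.+1 :> nat -> i <> j.+1 :> nat ->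
    pairing (b i) (b j) = 0;
  path_last : forall i j : 'I_k.+1, j = i.+1 :> nat ->
    pairing (b j) (b i) = -1 \/ pairing (b j) (b i) = -2 /\ e j = 1%N
}.

Section Base.

Variables (n : nat) (a : 'I_n -> V) (c : 'I_n -> nat).
Hypothesis ha : is_base Rp a.
Hypothesis hc : multipliers form R a c.
Hypothesis hh : forall j, 0 <= height form a c (a j).
Let a0 := base_neq0 hR hP ha.

Lemma base_nonempty : (0 < n)%N.
Proof.
have [ne _] := hirr; have /fset0Pn [b bR] : R != fset0 by apply/eqP.
have [x] := base_span hR hP ha b.
have [n0|//] := posnP n; rewrite big1 => [b0|i _]; last first.
  by exfalso; have := ltn_ord i; rewrite [X in (_ < X)%N]n0.
by have := root_neq0 hR; rewrite -b0 bR.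
Qed.

(** Otherwise every chain could be extended, and a chain with [n + 1] distinct vertices would
    exist. *)
Lemma maximal_chain : exists k p, chain form a c k p /\
  forall y, (forall t, (t <= k)%N -> p t != y) -> pairing (a (p k)) (a y) = 0.
Proof.
apply: contrapT => none.
have all_k k : exists p, chain form a c k p.
  elim: k => [|k [p hp]].
    have [j hj] := height_pos_exists hR hP ha hc hh base_nonempty.
    exists (fun=> j); split=> // s t; rewrite !leqn0 => /eqP -> /eqP ->.
    by [].
  apply: contrapT => nok; apply: none; exists k, p; split=> // y yn.
  apply/eqP/negP => /negP adj; apply: nok.
  by eexists; apply: (chain_extend hR hP ha hc hh hp yn adj).
have [p hp] := all_k n.
have pinj : injective (fun i : 'I_n.+1 => p i).
  move=> i j e; apply/val_inj/(chain_inj hp) => //; rewrite -ltnS; exact: ltn_ord.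
by have := leq_card _ pinj; rewrite !card_ord ltnn.
Qed.

(** No edge leaves a maximal chain: earlier vertices have only chain neighbours, and the last one is
    closed by maximality. By connectedness the chain exhausts the base. *)
Lemma dynkin_path_exists : exists k (s : 'I_k.+1 -> 'I_n),
  bijective s /\ dynkin_path (a \o s) (c \o s).
Proof.
have [k [p [hp closed]]] := maximal_chain.
have cn := mult_neq0 hc.
have surj i : [exists t : 'I_k.+1, p t == i].
  move: i; apply: (irreducible_connected hR hP ha hirr).
    by exists (p 0%N); apply/existsP; exists ord0.
  move=> i j /existsP [t /eqP <-] nj.
  have {}nj s : (s <= k)%N -> p s != j.
    move=> sk; apply: contra nj => e; apply/existsP.
    by exists (Ordinal (sk : s < k.+1)%N).
  have := ltn_ord t; rewrite ltnS leq_eqVlt => /predU1P [->|tk].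
    exact: closed.
  have nj' s : (s <= k)%N -> j != p s by move=> sk; rewrite eq_sym; apply: nj.
  apply: (chain_zero hp tk) => [||_]; apply: nj' => //; first exact: ltnW.
  exact: leq_trans (leq_pred _) (ltnW tk).
have ex i : exists t : 'I_k.+1, p t = i.
  by have /existsP [t /eqP <-] := surj i; exists t.
have [q qE] := choice ex.
have pinj (i j : 'I_k.+1) : p i = p j -> i = j.
  by move=> e; apply/val_inj/(chain_inj hp) => //; rewrite -ltnS; apply: ltn_ord.
exists k, (fun t => p t); split.
  by exists q => // t; apply: pinj; rewrite qE.
have lek (i : 'I_k.+1) : (i <= k)%N by rewrite -ltnS.
have next (i j : 'I_k.+1) : j = i.+1 :> nat ->
    pairing (a (p i)) (a (p j)) = - (c (p j))%:R.
  move=> ji; have ik : (i < k)%N by have := lek j; rewrite ji.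
  have := chain_next hp ik; rewrite -ji => /(congr1 -%R).
  rewrite opprK => /(congr1 (fun x => x * (c (p j))%:R)).
  by rewrite divfK // mulN1r.
have dist (i j : 'I_k.+1) : i != j -> p i != p j.
  by apply: contra_neq => /pinj.
have prev (i j : 'I_k.+1) : j = i.+1 :> nat -> (j < k)%N ->
    pairing (a (p j)) (a (p i)) = -1.
  move=> ji jk; have ik : (i < k)%N by have := lek j; rewrite ji.
  have jk' := jk; rewrite ji in jk'.
  have := chain_prev hp jk'; rewrite -ji (chain_one hp ik) divr1.
  by move=> <-; rewrite opprK.
have far_lt (i j : 'I_k.+1) : (i.+1 < j)%N -> pairing (a (p i)) (a (p j)) = 0.
  move=> ij; have ik : (i < k)%N by have := lek j; lia.
  have ne (s : nat) : (s <= k)%N -> (s < j)%N -> p j != p s.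
    move=> sk sj; apply/eqP => /(chain_inj hp (lek j) sk); lia.
  by apply: (chain_zero hp ik) => [||_]; apply: ne; lia.
split=> /=.
- by move=> i ik; apply: (chain_one hp).
- exact: next.
- exact: prev.
- move=> i j /[dup] /dist d ij h1 h2; have [lt|le] := ltnP i j.
    by apply: far_lt; lia.
  apply/eqP; rewrite pairing_eq0_sym //; apply/eqP/far_lt.
  by move: ij; rewrite -(inj_eq val_inj) /=; lia.
move=> i j ji.
have ik : (i < k)%N by have := lek j; rewrite ji.
have c1 : c (p i) = 1%N := chain_one hp ik.
have ij : p i != p j by apply: dist; apply/eqP => e; rewrite e in ji; lia.
have pz : pairing (a (p j)) (a (p i)) != 0.
  rewrite pairing_eq0_sym // next // oppr_eq0.
  exact: cn.
have := N_ge1 hR hP ha hc ij pz.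
have pji : p j \notin [:: p i] by rewrite inE eq_sym.
(* The column of the later vertex has nonnegative height, so the entry is at least [- 2 / c_j]; the
   value -2 is possible only when [c_j = 1]. *)
have := column_bound hR hP ha c (s := [:: p i]) isT pji.
rewrite big_seq1 c1 divr1 => b1 b2.
have hj := hh (p j).
have [z zE] := pairing_base_int hR hP ha (p j) (p i).
rewrite zE in b1 b2 *.
have z1 : z <= -1 by rewrite -(ler_int K); lra.
have z2 : -2 <= z.
  rewrite -(ler_int K); have := two_div_c hc (p j).
  by move=> ?; lra.
have [e|e] : z = -1 \/ z = -2 by lia.
  by left; rewrite e.
right; rewrite e in b1 *; split=> //.
by apply: (c_one hc); lra.
Qed.

End Base.

Lemma multipliers_comp n k (a : 'I_n -> V) c (s : 'I_k -> 'I_n) :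
  multipliers form R a c -> multipliers form R (a \o s) (c \o s).
Proof.
move=> hc; split=> [i|i|i j] /=; first exact: mult_or hc _.
  exact: (mult_double hc).
exact: (mult_int hc).
Qed.

Lemma scaled_lattice_comp n k (a : 'I_n -> V) c (s : 'I_k -> 'I_n) :
  bijective s -> scaled_lattice form (a \o s) (c \o s) = scaled_lattice form a c.
Proof.
move=> [t st ts]; apply/seteqP; split=> l hl i; last exact: hl.
by have := hl (t i); rewrite /= ts.
Qed.

Lemma quadratic_path L : quadratic form R Rp L ->
  exists k (b : 'I_k.+1 -> V) e, [/\ is_base Rp b, multipliers form R b e,
    L = scaled_lattice form b e & dynkin_path b e].
Proof.
have [n [a ha]] := base_exists hR hP.
move=> /(quadraticP hR hP ha) [c [hc LE hh]].
have [k [s [bs hs]]] := dynkin_path_exists ha hc hh.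
exists k, (a \o s), (c \o s); split=> //.
- exact: base_reindex.
- exact: multipliers_comp.
- by rewrite scaled_lattice_comp.
Qed.

End Path.

(** * From the path to the type *)

Section Forward.

Variables (K : realFieldType) (V : vectType K) (form : {dot V for idfun}).
Variables (R Rp : {fset V}).
Hypotheses (hR : root_system form R) (hP : positive_roots R Rp).
Local Notation pairing := (pairing form).
Local Notation E := (unit_row K _).
Local Notation X := entry.

Lemma weight_lattice_scaled n (a : 'I_n -> V) c : is_base Rp a ->
  multipliers form R a c -> (forall i, c i = 2%N -> 2 *: a i \in R) ->
  scaled_lattice form a c = weight_lattice form R.
Proof.
move=> ha hc h2; apply/seteqP; split; first exact: (scaled_lattice_weight hR hP ha hc).
move=> l /(weight_latticeP hR hP ha) hl i; have [li li2] := hl i.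
by case: (mult_or hc i) => ci; rewrite ci ?divr1 //; apply/li2/h2.
Qed.

Lemma rank1_root_lattice (a : 'I_1 -> V) c : is_base Rp a ->
  multipliers form R a c -> c ord0 = 2%N ->
  scaled_lattice form a c = root_lattice R.
Proof.
move=> ha hc c2; apply/seteqP; split; last exact: (scaled_lattice_root hP ha hc).
move=> l /(_ ord0) [z]; rewrite c2 => zE.
rewrite (_ : l = \sum_i a i *~ z).
  by apply: root_lattice_comb => i; apply: base_root ha i.
apply: (pairing_base_inj hR hP ha) => i; rewrite big_ord1 -scaler_int pairingZl.
rewrite (ord1 i) pairing_self ?(base_neq0 hR hP ha) // -zE divfK //.
by rewrite pnatr_eq0.
Qed.

(** In coordinates membership says that consecutive differences are integers. The coordinate beyond
    the last is 0, so all coordinates are integers, and the unit vectors are roots. *)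
Lemma frame_root_lattice n (a : 'I_n -> V) c d (f : 'Hom(V, 'rV[K]_n)) :
  is_base Rp a -> multipliers form R a c -> frame form a (fun i => (c i)%:R) d f ->
  subset (axis_vectors 1) [set f v | v in [set` R]]%classic ->
  scaled_lattice form a c = root_lattice R.
Proof.
move=> ha hc hf ax; apply/seteqP; split; last exact: (scaled_lattice_root hP ha hc).
move=> l hl.
have diff i : (i < n)%N -> is_integer (X i (f l) - X i.+1 (f l)).
  move=> lt; have := hl (Ordinal lt); rewrite (frame_pairing hf) /=.
  by rewrite mulrC mulKf // (mult_neq0 hc).
have ent k i : (i + k = n)%N -> is_integer (X i (f l)).
  elim: k i => [|k ih] i.
    by rewrite addn0 => ->; rewrite entry_out //; apply: is_integer0.
  rewrite addnS -addSn => ik; rewrite -[X i _](subrK (X i.+1 (f l))).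
  by apply: is_integerD; [apply: diff; lia | apply: ih].
have zP (i : 'I_n) : exists z : int, X i (f l) = z%:~R.
  by apply: (ent (n - i)%N); have := ltn_ord i; lia.
have [z zE] := choice zP.
have uP (i : 'I_n) : exists u, u \in R /\ f u = E i.
  have [|u /= uR <-] := ax (E i).
    by apply/axis_vectorsP; exists i, false; rewrite expr0 mul1r scale1r.
  by exists u.
have [u uE] := choice uP.
rewrite (_ : l = \sum_i u i *~ z i).
  by apply: root_lattice_comb => i; case: (uE i).
apply: (frame_inj hR hP ha hf); rewrite [LHS]row_entries linear_sum.
apply: eq_bigr => i _.
by rewrite -scaler_int linearZ /= (proj2 (uE i)) zE.
Qed.

Section Path.

Variables (k : nat) (b : 'I_k.+1 -> V) (e : 'I_k.+1 -> nat).
Hypotheses (hb : is_base Rp b) (he : multipliers form R b e).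
Hypothesis hp : dynkin_path form b e.

(** Away from neighbouring vertices both Cartan matrices vanish off the diagonal, so only the two
    entries on each edge need to be matched. *)
Lemma path_frame m c d : (k < m)%N ->
  (forall i : 'I_k.+1, c i * d i = if (i.+1 < m)%N then 1 else 2) ->
  (forall i j : 'I_k.+1, j = i.+1 :> nat ->
     pairing (b i) (b j) = - (c j * d i) /\ pairing (b j) (b i) = - (c i * d j)) ->
  exists f : 'Hom(V, 'rV[K]_m), frame form b c d f.
Proof.
move=> km hn hadj; apply: (frame_exists hR hP hb hn) => i j.
have lt (s : 'I_k.+1) : (s < m)%N by apply: leq_trans km.
rewrite !entryB !entry_unit lt eqSS.
have [<-|ij] := eqVneq i j.
  rewrite pairing_self ?(base_neq0 hR hP hb) // eqxx.
  have -> : (i == i.+1 :> nat) = false by apply/eqP; lia.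
  have -> : (i.+1 == i :> nat) = false by apply/eqP; lia.
  rewrite mulrA hn /=; case: ltnP => _ /=; rewrite !(mul1r, subr0, sub0r, opprK) //.
  by rewrite mulr1.
rewrite (inj_eq val_inj) (negPf ij) /=.
have [ij1|ij1] := eqVneq (i : nat) j.+1.
  have [-> _] := hadj j i ij1.
  have -> : (i.+1 == j :> nat) = false by apply/eqP; lia.
  by rewrite -ij1 lt /=; ring.
have [ji1|ji1] := eqVneq i.+1 (j : nat).
  have [_ ->] := hadj i j (esym ji1).
  by rewrite /=; ring.
rewrite /= !subr0 !mulr0; apply: (path_far hp).
- by rewrite eq_sym.
- by move/eqP; apply/negP.
by move/esym/eqP; apply/negP.
Qed.

Lemma path_type_A : (forall i j : 'I_k.+1, j = i.+1 :> nat ->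
     e j = 1%N /\ pairing (b j) (b i) = -1) ->
  (forall i, 2 *: b i \notin R) -> of_type_A R k.+1.
Proof.
move=> h no2.
have [f hf] : exists f : 'Hom(V, 'rV[K]_k.+2), frame form b (fun=> 1) (fun=> 1) f.
  apply: path_frame => // [i|i j ij]; first by rewrite ltnS ltn_ord mulr1.
  have [e1 ->] := h i j ij.
  by rewrite (path_next hp ij) e1 mulr1.
exists f; first exact: (frame_inj hR hP hb hf).
exact: (frame_differences hR hP hb hf no2).
Qed.

Lemma path_one_all : e ord_max = 1%N -> forall i, e i = 1%N.
Proof.
move=> e1 i; have := ltn_ord i; rewrite ltnS leq_eqVlt => /predU1P [ik|].
  by rewrite -e1; congr e; apply/val_inj.
exact: (path_one hp).
Qed.

Lemma last_cases (i j : 'I_k.+1) : j = i.+1 :> nat -> (j < k)%N \/ j = ord_max.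
Proof.
move=> _; have := ltn_ord j; rewrite ltnS leq_eqVlt => /predU1P [jk|]; last by left.
by right; apply/val_inj.
Qed.

Lemma path_type_C : e ord_max = 1%N ->
  (forall i j : 'I_k.+1, j = i.+1 :> nat -> j = ord_max -> pairing (b j) (b i) = -2) ->
  (forall i, 2 *: b i \notin R) -> of_type_C R k.+1.
Proof.
move=> e1 h no2; have e1' := path_one_all e1.
have [f hf] : exists f : 'Hom(V, 'rV[K]_k.+1), frame form b (fun=> 1) (last_scale 2) f.
  apply: path_frame => // [i|i j ij]; first by rewrite mul1r.
  have ik : (i < k)%N by have := ltn_ord j; rewrite ij ltnS.
  rewrite (path_next hp ij) e1' /last_scale ik !mul1r; split=> //.
  have [jk|jE] := last_cases ij; first by rewrite jk (path_prev hp).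
  by rewrite (h i j) // jE ltnn.
exists f; first exact: (frame_inj hR hP hb hf).
rewrite rootsC_signed.
apply: (frame_signed_roots hR hP hb hf); first by rewrite inE.
  by move=> i; rewrite (negPf (no2 i)).
by move=> t; rewrite inE => /eqP ->; left.
Qed.

Lemma path_frame_short : e ord_max = 2%N ->
  exists f : 'Hom(V, 'rV[K]_k.+1), frame form b (fun i => (e i)%:R) (last_scale 1) f.
Proof.
move=> e2; have one (i : 'I_k.+1) : last_scale 1 i = 1 :> K.
  by rewrite /last_scale if_same.
apply: path_frame => // [i|i j ij]; rewrite !one !mulr1.
  have := ltn_ord i; rewrite ltnS leq_eqVlt => /predU1P [ik|ik].
    by rewrite ik ltnn (_ : i = ord_max) ?e2 //; apply/val_inj.
  by rewrite (path_one hp ik) ltnS ik.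
have ik : (i < k)%N by have := ltn_ord j; rewrite ij ltnS.
rewrite (path_next hp ij) (path_one hp ik); split=> //.
have [jk|jE] := last_cases ij; first by rewrite (path_prev hp).
by case: (path_last hp ij) => // [[_]]; rewrite jE e2.
Qed.

Lemma doubled_last i : 2 *: b i \in R -> i = ord_max.
Proof.
move=> i2; have := ltn_ord i; rewrite ltnS leq_eqVlt => /predU1P [ik|ik].
  exact/val_inj.
by have := mult_double he i2; rewrite (path_one hp ik).
Qed.

Lemma path_type_B : e ord_max = 2%N -> 2 *: b ord_max \notin R ->
  of_type_B R k.+1 /\ scaled_lattice form b e = root_lattice R.
Proof.
move=> e2 no2; have [f hf] := path_frame_short e2.
have im : [set f v | v in [set` R]]%classic = @rootsB K k.+1.
  rewrite rootsB_signed; apply: (frame_signed_roots hR hP hb hf); first by rewrite inE.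
    by move=> i /[dup] /doubled_last ->; rewrite (negPf no2).
  by move=> t; rewrite inE => /eqP ->; left.
split; first by exists f => //; apply: (frame_inj hR hP hb hf).
apply: (frame_root_lattice hb he hf); rewrite im => x h.
by right.
Qed.

Lemma path_type_BC : e ord_max = 2%N -> 2 *: b ord_max \in R -> of_type_BC R k.+1.
Proof.
move=> e2 r2; have [f hf] := path_frame_short e2.
exists f; first exact: (frame_inj hR hP hb hf).
rewrite rootsBC_signed; apply: (frame_signed_roots hR hP hb hf).
- by rewrite !inE eqxx.
- by move=> i /doubled_last ->; rewrite mulr1 !inE eqxx orbT.
by move=> t; rewrite !inE mulr1 => /orP [] /eqP ->; [left | right].
Qed.

End Path.

(** The last multiplier decides. If it is 1, the lattice is [P] and the last bond separates A from
    C. If it is 2, a doubled last root gives BC with [P], and otherwise the type is B with [Q],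
    which in rank one is [A_1]. *)
Lemma quadratic_types (L : set V) : irreducible_roots form R ->
  quadratic form R Rp L ->
  [\/ of_type_A R 1 /\ (L = weight_lattice form R \/ L = root_lattice R),
      of_type_BC R 1 /\ L = weight_lattice form R,
      exists l : nat, [/\ (2 <= l)%N,
        [\/ of_type_A R l, of_type_C R l | of_type_BC R l] & L = weight_lattice form R]
    | exists l : nat, [/\ (2 <= l)%N, of_type_B R l & L = root_lattice R]].
Proof.
move=> irr /(quadratic_path hR hP irr) [k [b [e [hb he -> hp]]]].
have [e1|e2] := mult_or he ord_max.
  have e1' := path_one_all hp e1.
  have no2 i : 2 *: b i \notin R.
    by apply/negP => /(mult_double he); rewrite e1'.
  have LP : scaled_lattice form b e = weight_lattice form R.
    by apply: weight_lattice_scaled => // i; rewrite e1'.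
  case: k => [|k] in b e hb he hp e1 e1' no2 LP *.
    constructor 1; split; last by left.
    by apply: (path_type_A hb hp) => // i j; rewrite !ord1.
  constructor 3; exists k.+2; split=> //.
  pose i : 'I_k.+2 := inord k.
  have ij : (ord_max : 'I_k.+2) = i.+1 :> nat by rewrite /i inordK /=.
  have uniq_i (i' : 'I_k.+2) : (ord_max : 'I_k.+2) = i'.+1 :> nat -> i' = i.
    by rewrite ij => [[e']]; apply/val_inj.
  have [p1|[p2 _]] := path_last hp ij.
    constructor 1; apply: (path_type_A hb hp) => // s t st.
    split; first exact: e1'.
    have [jk|jE] := last_cases st; first exact: (path_prev hp st).
    by rewrite jE (uniq_i s) // -jE.
  constructor 2; apply: (path_type_C hb hp) => // s t st jE.
  by rewrite jE (uniq_i s) // -jE.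
have [r2|no2] := boolP (2 *: b ord_max \in R).
  have LP : scaled_lattice form b e = weight_lattice form R.
    apply: weight_lattice_scaled => // i ei.
    suff -> : i = ord_max by [].
    have := ltn_ord i; rewrite ltnS leq_eqVlt => /predU1P [ik|ik]; first exact/val_inj.
    by have := path_one hp ik; rewrite ei.
  have BC := path_type_BC hb he hp e2 r2.
  case: k => [|k] in b e hb he hp e2 r2 LP BC *; first by constructor 2.
  by constructor 3; exists k.+2; split=> //; constructor 3.
case: k => [|k] in b e hb he hp e2 no2 *.
  have m0 : (ord_max : 'I_1) = ord0 by apply/val_inj.
  rewrite m0 in e2 no2; constructor 1; split.
    by apply: (path_type_A hb hp) => [i j|i]; rewrite !ord1.
  by right; apply: rank1_root_lattice.
have [B LQ] := path_type_B hb he hp e2 no2.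
by constructor 4; exists k.+2.
Qed.

End Forward.

(** * From the type to the path *)

Section Ordering.

Variable m : nat.

(** The permutation sorts the indices; [r'] is the reflexive closure, since sorting requires a total
    relation. *)
Lemma order_perm (r : rel 'I_m) : transitive r ->
  (forall i j, i != j -> r i j || r j i) ->
  exists s : {perm 'I_m}, forall i j : 'I_m, (i < j)%N -> r (s i) (s j).
Proof.
move=> tr tot; pose r' i j := (i == j) || r i j.
have tr' : transitive r'.
  move=> j i k /predU1P [->//|ij] /predU1P [<-|jk].
    by rewrite /r' ij orbT.
  by rewrite /r' (tr _ _ _ ij jk) orbT.
have tot' : total r'.
  move=> i j; rewrite /r' [j == i]eq_sym; case: eqVneq => //= ij.
  exact: tot.
pose t := sort r' (enum 'I_m).
have st : size t = m by rewrite size_sort size_enum_ord.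
have ut : uniq t by rewrite sort_uniq enum_uniq.
have sinj : injective (fun i : 'I_m => nth i t i).
  move=> i j /eqP; rewrite (set_nth_default j) ?st // nth_uniq ?st // => /eqP.
  exact: val_inj.
exists (perm sinj) => i j ij; rewrite !permE.
rewrite (set_nth_default j) ?st //.
have := sorted_ltn_nth tr' j (sort_sorted tot' (enum 'I_m)).
rewrite -/t => /(_ i j); rewrite !inE !st !ltn_ord => /(_ isT isT ij) /predU1P [/eqP|//].
by rewrite nth_uniq ?st // ltn_eqF.
Qed.

End Ordering.

Section Relabel.

Variables (K : realFieldType) (m : nat).
Implicit Types (s : {perm 'I_m}) (o : 'I_m -> bool).
Local Notation E := (unit_row K m).

(** Signed permutations preserve the signed models, and unsigned ones preserve type A; they are used
    to make a positive system standard. *)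
Definition relabel s o (x : 'rV[K]_m) : 'rV[K]_m :=
  \row_i ((-1) ^+ o i * x 0 (s i)).

Lemma relabel_is_linear s o : linear (relabel s o).
Proof. by move=> k x y; apply/rowP => i; rewrite !mxE; ring. Qed.

HB.instance Definition _ s o :=
  GRing.isLinear.Build K 'rV[K]_m 'rV[K]_m _ (relabel s o) (relabel_is_linear s o).

Lemma relabel_unit s o (j : 'I_m) :
  relabel s o (E j) = (-1) ^+ o ((s^-1)%g j) *: E ((s^-1)%g j).
Proof.
apply/rowP => i; rewrite !mxE.
rewrite !(inj_eq val_inj) (canF_eq (permK s)).
by case: eqP => [->//|]; rewrite !mulr0.
Qed.

Lemma relabelK s o :
  cancel (relabel s o) (relabel (s^-1)%g (fun i => o ((s^-1)%g i))).
Proof.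
move=> x; apply/rowP => i; rewrite !mxE mulrA -expr2 sqrr_sign mul1r.
by rewrite permKV.
Qed.

Lemma relabelKV s o :
  cancel (relabel (s^-1)%g (fun i => o ((s^-1)%g i))) (relabel s o).
Proof.
by move=> x; apply/rowP => i; rewrite !mxE permK mulrA -expr2 sqrr_sign mul1r.
Qed.

Lemma relabel_differences s x :
  @differences K m x -> differences (relabel s (fun=> false) x).
Proof.
move=> [i [j [ij ->]]]; exists ((s^-1)%g i), ((s^-1)%g j).
rewrite (inj_eq perm_inj) -!unit_row_ord linearB /= !relabel_unit.
by rewrite expr0 !scale1r.
Qed.

Lemma relabel_signed_roots s o ks x :
  @signed_roots K m ks x -> signed_roots ks (relabel s o x).
Proof.
case=> [[i [j [e [d [ij ->]]]]]|[k kk [i [e ->]]]].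
  left; exists ((s^-1)%g i), ((s^-1)%g j),
    (e (+) o ((s^-1)%g i)), (d (+) o ((s^-1)%g j)).
  rewrite (inj_eq perm_inj) -!unit_row_ord linearD !linearZ /= !relabel_unit.
  by rewrite !scalerA !signr_addb.
right; exists k => //; exists ((s^-1)%g i), (e (+) o ((s^-1)%g i)).
by rewrite -!unit_row_ord linearZ /= relabel_unit scalerA signr_addb mulrAC.
Qed.

End Relabel.

Section Models.

Variables (K : realFieldType) (V : vectType K) (form : {dot V for idfun}).
Variables (R Rp : {fset V}).
Hypotheses (hR : root_system form R) (hP : positive_roots R Rp).
Local Notation pairing := (pairing form).
Local Notation E := (unit_row K _).
Local Notation X := entry.

Definition pos_image m (f : 'Hom(V, 'rV[K]_m)) (x : 'rV[K]_m) : Prop :=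
  exists2 b, b \in Rp & f b = x.

Section Image.

Variables (m : nat) (f : 'Hom(V, 'rV[K]_m)) (M : set 'rV[K]_m).
Hypotheses (finj : injective f) (fM : [set f v | v in [set` R]]%classic = M).

Lemma image_root v : M (f v) -> v \in R.
Proof. by rewrite -fM => [[u /= uR /finj <-]]. Qed.

Lemma root_image v : v \in R -> M (f v).
Proof. by rewrite -fM => vR; exists v. Qed.

Lemma pos_image_or x : M x -> pos_image f x \/ pos_image f (- x).
Proof.
rewrite -fM => [[b /= bR <-]]; case: (pos_or_opp hP bR) => bp; [left | right].
  by exists b.
by exists (- b); rewrite ?linearN.
Qed.

Lemma pos_imageN x : pos_image f x -> ~ pos_image f (- x).
Proof.
move=> [b bp <-] [b' b'p]; rewrite -linearN => /finj e.
by have := pos_opp hP (root_of_pos hP bp); rewrite -e b'p bp.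
Qed.

Lemma pos_imageD x y : pos_image f x -> pos_image f y -> M (x + y) ->
  pos_image f (x + y).
Proof.
move=> [b bp <-] [b' b'p <-]; rewrite -linearD => /image_root h.
by exists (b + b') => //; apply: (pos_closed hP).
Qed.

(** The map [f] says nothing about [form]. The coordinate functional has value 2 at [a i] and its
    reflection preserves the roots, so [pairing_unique] identifies it with the coroot. *)
Lemma model_frame n (a : 'I_n -> V) c d : (n <= m)%N ->
  (forall i, a i \in Rp) -> (forall i, f (a i) = d i *: (E i - E i.+1)) ->
  (forall i : 'I_n, c i * d i = if (i.+1 < m)%N then 1 else 2) ->
  (forall (i : 'I_n) x, M x -> M (row_refl i x)) ->
  frame form a c d f.
Proof.
move=> nm ap fa cd Mr; split=> // v i.
have lt : (i < m)%N by apply: leq_trans nm.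
have aR : a i \in R by apply: (root_of_pos hP).
pose phi v := c i * (X i (f v) - X i.+1 (f v)).
apply/esym; apply: (pairing_unique hR (phi := phi)) => // [k u w||b bR].
- by rewrite /phi linearP !entryD !entryZ; ring.
- rewrite /phi fa !entryZ -mulrBr mulrA cd !entryB !entry_unit lt eqxx eqSS eqxx.
  have -> : (i == i.+1 :> nat) = false by apply/eqP; lia.
  have -> : (i.+1 == i :> nat) = false by apply/eqP; lia.
  by case: ltnP => _ /=; ring.
apply: image_root; rewrite linearB linearZ /= fa /phi scalerA mulrAC cd.
exact/Mr/root_image.
Qed.

Lemma model_relabel (s : {perm 'I_m}) (o : 'I_m -> bool) :
  (forall x, M x -> M (relabel s o x)) ->
  (forall x, M x -> M (relabel (s^-1)%g (fun i => o ((s^-1)%g i)) x)) ->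
  exists f' : 'Hom(V, 'rV[K]_m), [/\ injective f',
    [set f' v | v in [set` R]]%classic = M
    & forall x, pos_image f x -> pos_image f' (relabel s o x)].
Proof.
move=> h1 h2; pose g : 'Hom('rV[K]_m, 'rV[K]_m) := linfun (relabel s o).
have gE v : (g \o f)%VF v = relabel s o (f v) by rewrite lfunE /= lfunE.
exists (g \o f)%VF; split.
- by move=> u v; rewrite !gE => /(can_inj (relabelK s o)) /finj.
- apply/seteqP; split=> [x [v /= vR <-]|x Mx]; first by rewrite gE; apply/h1/root_image.
  have := h2 x Mx; rewrite -fM => [[v /= vR e]]; exists v => //.
  by rewrite gE e relabelKV.
by move=> x [b bp <-]; exists b; rewrite ?gE.
Qed.

End Image.

Section Comb.

Variables (n m : nat) (a : 'I_n -> V) (d : 'I_n -> K) (f : 'Hom(V, 'rV[K]_m)).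
Hypotheses (finj : injective f) (nm : (n <= m)%N).
Hypotheses (ap : forall i, a i \in Rp) (d0 : forall i, d i != 0).
Hypothesis fa : forall i, f (a i) = d i *: (E i - E i.+1).

Definition nat_comb (x : 'rV[K]_m) : Prop :=
  exists c : 'I_n -> nat, x = \sum_i f (a i) *+ c i.

Lemma nat_combD x y : nat_comb x -> nat_comb y -> nat_comb (x + y).
Proof.
move=> [c ->] [c' ->]; exists (fun i => c i + c' i)%N.
by rewrite -big_split; apply: eq_bigr => i _; rewrite mulrnDr.
Qed.

Lemma nat_comb_base i : nat_comb (f (a i)).
Proof.
exists (fun j => (j == i) : nat).
by rewrite (bigD1 i) //= eqxx big1 ?addr0 // => j /negPf ->.
Qed.

(* The sum of the first [j + 1] coordinates is the coordinate functional of
   [E j - E j.+1]. *)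
Lemma model_free (x : 'I_n -> K) : \sum_i x i *: a i = 0 -> forall i, x i = 0.
Proof.
move=> x0 j; have := congr1 (fun v => \sum_(k < j.+1) X k (f v)) x0.
rewrite /= [in RHS]linear0 [RHS]big1 => [|k _]; last exact: entry0.
rewrite linear_sum; under eq_bigr => k _ do rewrite entry_sum.
have lt (i : 'I_n) : (i < m)%N by apply: leq_trans nm.
have cnt t : \sum_(k < j.+1) (((k : nat) == t) && (t < m)%N)%:R =
    ((t < j.+1) && (t < m))%N%:R :> K.
  have [tj|jt] := ltnP t j.+1.
    rewrite (bigD1 (Ordinal tj)) //= eqxx big1 ?addr0 // => k kt.
    by case: eqP => // e; case/eqP: kt; apply/val_inj.
  by rewrite big1 // => k _; rewrite ltn_eqF // (leq_trans (ltn_ord k)).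
have term i : \sum_(k < j.+1) X k (f (x i *: a i)) =
    x i * (d i * ((i < j.+1)%N%:R - ((i.+1 < j.+1) && (i.+1 < m))%N%:R)).
  under eq_bigr => k _ do rewrite linearZ /= fa !entryZ entryB !entry_unit.
  by rewrite -!mulr_sumr sumrB !cnt lt andbT.
rewrite exchange_big /= (bigD1 j) //= [X in _ + X]big1 => [|i ij].
  rewrite term ltnSn ltnn subr0 mulr1 addr0 => /eqP.
  by rewrite mulf_eq0 (negPf (d0 j)) orbF => /eqP.
rewrite term; suff -> : (i < j.+1)%N = (i.+1 < j.+1)%N && (i.+1 < m)%N.
  by rewrite subrr !mulr0.
move: ij (lt j); rewrite -(inj_eq val_inj) /=; lia.
Qed.

Lemma model_base : (forall b, b \in Rp -> nat_comb (f b)) -> is_base Rp a.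
Proof.
move=> h; split=> //; first exact: model_free.
move=> b /h [c cE]; exists c; apply: finj; rewrite cE linear_sum.
by apply: eq_bigr => i _; rewrite linearMn.
Qed.

Lemma nat_comb_diff : (forall i : 'I_n, (i.+1 < m)%N -> d i = 1) ->
  (m <= n.+1)%N -> forall i j, (i < j)%N -> (j < m)%N -> nat_comb (E i - E j).
Proof.
move=> d1 mn i j ij; rewrite -(subnKC ij) addSnnS; move: (j - i.+1)%N => k.
have step t : (t.+1 < m)%N -> nat_comb (E t - E t.+1).
  move=> tm; have tn : (t < n)%N by lia.
  have := nat_comb_base (Ordinal tn); rewrite fa d1 //.
  by rewrite scale1r.
elim: k => [|k ih] im; first by rewrite addn1 in im *; apply: step.
rewrite addnS in im *.
rewrite -[E i](subrK (E (i + k.+1))) -addrA; apply: nat_combD; first exact/ih/ltnW.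
exact: step.
Qed.

(** Division by [c] cancels the coroot factors, and the sum telescopes to coordinate 0 minus
    coordinate [n]. On a simple root neither part is negative. *)
Lemma frame_height c : frame form a (fun i => (c i)%:R) d f ->
  (forall i, (c i)%:R != 0 :> K) -> (forall i, 0 <= d i) ->
  forall j, 0 <= height form a c (a j).
Proof.
move=> hf cn dge j; rewrite /height.
under eq_bigr => i _ do rewrite (frame_pairing hf) mulrC mulKf //.
rewrite -(big_mkord predT (fun i => X i (f (a j)) - X i.+1 (f (a j)))) /=.
under eq_bigr => i _ do rewrite -opprB.
rewrite sumrN telescope_sumr // opprB fa !entryZ -mulrBr mulr_ge0 //.
rewrite !entryB !entry_unit /= [in X in _ - (X - _)]gtn_eqF ?ltn_ord //=.
by rewrite subr0 sub0r opprK addr_ge0.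
Qed.

Lemma frame_multipliers c : frame form a (fun i => (c i)%:R) d f ->
  (forall i, c i = 1%N \/ c i = 2%N) -> (forall i, 2 *: a i \in R -> c i = 2%N) ->
  (forall i, is_integer (d i)) -> multipliers form R a c.
Proof.
move=> hf c12 c2 dint; split=> // i j.
rewrite (frame_pairing hf) mulrC mulKf; last by rewrite pnatr_eq0; case: (c12 i) => ->.
rewrite fa !entryZ -mulrBr; apply: is_integerM => //.
by rewrite !entryB !entry_unit; do !apply: is_integerB; apply: is_integer_nat.
Qed.

End Comb.

End Models.

(** * Standard positive systems and quadraticity of the models *)

Section Converse.

Variables (K : realFieldType) (V : vectType K) (form : {dot V for idfun}).
Variables (R Rp : {fset V}).
Hypotheses (hR : root_system form R) (hP : positive_roots R Rp).
Local Notation pairing := (pairing form).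
Local Notation E := (unit_row K _).
Local Notation X := entry.

(** Positivity of [E i - E j] is a strict total order on the indices; sorting them makes it the
    usual one. *)
Lemma type_A_ordered l : of_type_A R l -> exists f : 'Hom(V, 'rV[K]_l.+1),
  [/\ injective f, [set f v | v in [set` R]]%classic = @differences K l.+1
    & forall i j, (i < j)%N -> (j < l.+1)%N -> pos_image Rp f (E i - E j)].
Proof.
move=> [f finj fM].
have mem (i j : 'I_l.+1) : i != j -> @differences K l.+1 (E i - E j).
  by move=> ij; apply/differencesP; exists i, j.
pose r (i j : 'I_l.+1) := `[< pos_image Rp f (E i - E j) >].
have tr : transitive r.
  move=> j i k /asboolP ij /asboolP jk; apply/asboolP.
  have [ik|ik] := eqVneq i k.
    by case: (pos_imageN hP finj ij); rewrite opprB ik.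
  have eq : E i - E k = (E i - E j) + (E j - E k) :> 'rV[K]_l.+1.
    by rewrite addrA subrK.
  by rewrite eq; apply: (pos_imageD hP finj fM) => //; rewrite -eq; apply: mem.
have [s sP] : exists s : {perm 'I_l.+1}, forall i j : 'I_l.+1, (i < j)%N -> r (s i) (s j).
  apply: order_perm => // i j ij; apply/orP.
  case: (pos_image_or hP fM (mem i j ij)) => h; [left | right]; apply/asboolP => //.
  by rewrite -opprB.
have [f' [f'inj f'M f'P]] := model_relabel (s := s) (o := fun=> false) Rp finj fM
  (@relabel_differences K _ s) (@relabel_differences K _ (s^-1)%g).
exists f'; split=> // i j ij jl.
have il := ltn_trans ij jl.
have := sP (Ordinal il) (Ordinal jl) ij => /asboolP/f'P.
by rewrite linearB /= !relabel_unit !permK expr0 !scale1r.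
Qed.

Lemma type_A_base l : of_type_A R l ->
  exists (a : 'I_l -> V) (f : 'Hom(V, 'rV[K]_l.+1)),
  [/\ is_base Rp a, frame form a (fun=> 1) (fun=> 1) f
    & forall i, 2 *: a i \notin R].
Proof.
move=> /type_A_ordered [f [finj fM fpos]].
have aP (i : 'I_l) : exists b, b \in Rp /\ f b = 1 *: (E i - E i.+1).
  have [b bp bE] := fpos i i.+1 (ltnSn i) (ltn_ord i).
  by exists b; rewrite scale1r.
have [a aE] := choice aP.
have ap i : a i \in Rp by case: (aE i).
have fa i : f (a i) = 1 *: (E i - E i.+1) by case: (aE i).
exists a, f; split.
- apply: (model_base finj _ ap (d := fun=> 1)) => // [i|b bp]; first exact: oner_neq0.
  have /differencesP [i [j [im jm ij e]]] : @differences K l.+1 (f b).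
    by apply: (root_image fM); apply: (root_of_pos hP).
  rewrite e; case: (ltnP i j) => lt.
    by apply: (nat_comb_diff (d := fun=> 1)) => //; exact: leqnSn.
  have ji : (j < i)%N by rewrite ltn_neqAle eq_sym ij.
  have [] := pos_imageN hP finj (fpos j i ji im).
  by rewrite opprB -e; exists b.
- apply: (model_frame hR hP finj fM) => // [i|i x].
  + by rewrite ltnS ltn_ord mulr1.
  by apply: differences_refl; rewrite ltnS.
move=> i; apply/negP => /(root_image fM).
rewrite linearZ /= fa scale1r => /differencesP [s [t [sl tl st]]].
have il : (i < l.+1)%N by rewrite ltnW // ltnS.
move=> /(congr1 (X i)); rewrite entryZ !entryB !entry_unit il sl tl eqxx /=.
rewrite (ltn_eqF (ltnSn i)) /= subr0 mulr1.
by case: eqP => _; case: eqP => _ h; exfalso; move: h => /=; lra.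
Qed.

Section Signed.

(** Here [t] is the length of the shortest axis roots: [t] and [ks] are 1 and [[:: 1]] for B, 2 and
    [[:: 2]] for C, 1 and [[:: 1; 2]] for BC. *)
Variables (l : nat) (t : K) (ks : seq K).
Hypotheses (t12 : t = 1 \/ t = 2) (tk : t \in ks).
Hypothesis kP : forall k, k \in ks -> k = t \/ k = 2 /\ t = 1.
Local Notation M := (@signed_roots K l.+1 ks).

(** Signs are first chosen so that all axis vectors [t *: E i] become positive; the differences of
    the resulting unit vectors then order the indices as in type A. *)
Lemma signed_ordered : isomorphic_to R M -> exists f : 'Hom(V, 'rV[K]_l.+1),
  [/\ injective f, [set f v | v in [set` R]]%classic = M,
      forall i j, (i < j)%N -> (j < l.+1)%N -> pos_image Rp f (E i - E j)
    & forall i, (i < l.+1)%N -> pos_image Rp f (t *: E i)].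
Proof.
move=> [f finj fM].
have oP (i : 'I_l.+1) : exists o : bool, pos_image Rp f ((-1) ^+ o *: (t *: E i)).
  have : M (t *: E i).
    right; exists t => //; apply/axis_vectorsP; exists i, false.
    by rewrite expr0 mul1r.
  move=> /(pos_image_or hP fM) [h|h]; first by exists false; rewrite expr0 scale1r.
  by exists true; rewrite expr1 scaleN1r.
have [o oE] := choice oP.
pose E' (i : 'I_l.+1) : 'rV[K]_l.+1 := (-1) ^+ o i *: E i.
have mem (i j : 'I_l.+1) : i != j -> M (E' i - E' j).
  move=> ij; left; apply/sums_and_differencesP; exists i, j, (o i), (~~ o j).
  by rewrite signrN scaleNr.
pose r (i j : 'I_l.+1) := `[< pos_image Rp f (E' i - E' j) >].
have tr : transitive r.
  move=> j i k /asboolP ij /asboolP jk; apply/asboolP.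
  have [ik|ik] := eqVneq i k.
    by case: (pos_imageN hP finj ij); rewrite opprB ik.
  have eq : E' i - E' k = (E' i - E' j) + (E' j - E' k) by rewrite addrA subrK.
  by rewrite eq; apply: (pos_imageD hP finj fM) => //; rewrite -eq; apply: mem.
have [s sP] : exists s : {perm 'I_l.+1}, forall i j : 'I_l.+1, (i < j)%N -> r (s i) (s j).
  apply: order_perm => // i j ij; apply/orP.
  case: (pos_image_or hP fM (mem i j ij)) => h; [left | right]; apply/asboolP => //.
  by rewrite -opprB.
pose os i := o (s i).
have [f' [f'inj f'M f'P]] := model_relabel (s := s) (o := os) Rp finj fM
  (@relabel_signed_roots K _ s os ks) (@relabel_signed_roots K _ (s^-1)%g _ ks).
have relE i : relabel s os (E' (s i)) = E i.
  rewrite linearZ /= relabel_unit permK scalerA /os -signr_addb addbb.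
  by rewrite expr0 scale1r.
exists f'; split=> // [i j ij jl|i il].
  have il := ltn_trans ij jl.
  have := sP (Ordinal il) (Ordinal jl) ij => /asboolP/f'P.
  by rewrite linearB /= !relE.
have /f'P := oE (s (Ordinal il)).
by rewrite scalerA mulrC -scalerA linearZ /= relE.
Qed.

(** This detects which doubled simple roots are roots: a doubled simple root has a coordinate
    greater than 1, so it must be an axis vector. *)
Lemma signed_roots_large i x : M x -> 1 < X i x -> exists2 k, k \in ks & x = k *: E i.
Proof.
case=> [/sums_and_differencesP [p [q [s [u [pl ql pq ->]]]]]|[k kk]].
  rewrite entryD !entryZ !entry_unit pl ql !andbT.
  have [ip|ip] := eqVneq i p; have [iq|iq] := eqVneq i q.
  - by rewrite -ip iq eqxx in pq.
  - by case: s; rewrite ?expr0 ?expr1 => h; exfalso; move: h => /=; lra.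
  - by case: u; rewrite ?expr0 ?expr1 => h; exfalso; move: h => /=; lra.
  by move=> h; exfalso; move: h => /=; lra.
move=> /axis_vectorsP [p [s [pl ->]]]; rewrite entryZ entry_unit pl andbT.
have [<-|ip] := eqVneq i p; last by move=> h; exfalso; move: h => /=; lra.
case: s; rewrite ?expr0 ?expr1 => h; last by exists k; rewrite ?mul1r.
have k0 : 0 <= k.
  by case: (kP kk) => [->|[-> _]]; rewrite ?ler0n //; case: t12 => ->; rewrite ?ler01 ?ler0n.
by exfalso; move: h; rewrite /=; lra.
Qed.

(** Differences telescope into simple roots, and a sum is a difference plus [2 *: E j]. Each root of
    the model is, up to sign, a known positive one, so a positive root of the wrong sign is
    excluded. *)
Lemma signed_base : isomorphic_to R M ->
  exists (a : 'I_l.+1 -> V) (f : 'Hom(V, 'rV[K]_l.+1)),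
  [/\ is_base Rp a, [set f v | v in [set` R]]%classic = M,
      forall c : 'I_l.+1 -> K,
        (forall i, c i * last_scale t i = if (i.+1 < l.+1)%N then 1 else 2) ->
        frame form a c (last_scale t) f,
      forall i, 2 *: a i \in R -> i = ord_max /\ 2 * t \in ks
    & 2 * t \in ks -> 2 *: a ord_max \in R].
Proof.
move=> /signed_ordered [f [finj fM fdiff faxis]].
have t0 : t != 0 by case: t12 => ->; rewrite ?oner_neq0 ?pnatr_eq0.
have lastE : E l - E l.+1 = E l :> 'rV[K]_l.+1 by rewrite (unit_row_out K (leqnn l.+1)) subr0.
have aP (i : 'I_l.+1) : exists b, b \in Rp /\ f b = last_scale t i *: (E i - E i.+1).
  rewrite /last_scale; case: ltnP => il.
    have [b bp bE] := fdiff i i.+1 (ltnSn i) il.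
    by exists b; rewrite scale1r.
  have -> : i = l :> nat by apply/eqP; rewrite eqn_leq il -ltnS ltn_ord.
  have [b bp bE] := faxis l (ltnSn l).
  by exists b; rewrite lastE.
have [a aE] := choice aP.
have ap i : a i \in Rp by case: (aE i).
have fa i : f (a i) = last_scale t i *: (E i - E i.+1) by case: (aE i).
have flast : f (a ord_max) = t *: E l by rewrite fa /last_scale ltnn lastE.
have comb := @nat_comb_diff _ _ _ _ a (last_scale t) f (leqnn _) fa.
have diff i j : (i < j)%N -> (j < l.+1)%N -> nat_comb a f (E i - E j).
  by apply: comb => // p pl; rewrite /last_scale (pl : p < l)%N.
have tnat x : nat_comb a f x -> nat_comb a f (t *: x).
  by case: t12 => ->; rewrite ?scale1r // scaler_nat mulr2n => h; apply: nat_combD.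
have axis i : (i < l.+1)%N -> nat_comb a f (t *: E i).
  move=> il; rewrite -[E i](subrK (E l)) scalerDr.
  have al : nat_comb a f (t *: E l) by rewrite -flast; apply: nat_comb_base.
  move: il; rewrite ltnS leq_eqVlt => /predU1P [->|il].
    by rewrite subrr scaler0 add0r.
  by apply: nat_combD => //; apply/tnat/diff.
have axis2 i : (i < l.+1)%N -> nat_comb a f (2 *: E i).
  move=> /axis; case: t12 => -> //; rewrite scale1r scaler_nat mulr2n => h.
  exact: nat_combD.
have sum i j : (i < j)%N -> (j < l.+1)%N -> nat_comb a f (E i + E j).
  move=> ij jl; have -> : E i + E j = (E i - E j) + 2 *: E j :> 'rV[K]_l.+1.
    by rewrite scaler_nat mulr2n addrA subrK.
  by apply: nat_combD; [apply: diff | apply: axis2].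
have Msum i j : (i < j)%N -> (j < l.+1)%N -> M (E i + E j).
  move=> ij jl; left; apply/sums_and_differencesP; exists i, j, false, false.
  by rewrite expr0 !scale1r (ltn_trans ij jl) ltn_eqF.
have psum i j : (i < j)%N -> (j < l.+1)%N -> pos_image Rp f (E i + E j).
  move=> ij jl; have Mij := Msum i j ij jl; have il := ltn_trans ij jl.
  (* For [t = 1] the sum is a sum of two short positive roots, as [2 *: E j] need not be a root; for
     [t = 2] it is a difference plus the long root [2 *: E j]. *)
  have [t1|t2] := t12.
    apply: (pos_imageD hP finj fM) => //.
      by have := faxis i il; rewrite t1 scale1r.
    by have := faxis j jl; rewrite t1 scale1r.
  have e : E i + E j = (E i - E j) + t *: E j :> 'rV[K]_l.+1.
    by rewrite t2 scaler_nat mulr2n addrA subrK.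
  by rewrite e in Mij *; apply: (pos_imageD hP finj fM) => //; [apply: fdiff | apply: faxis].
have Maxis k i : k \in ks -> (i < l.+1)%N -> M (k *: E i).
  move=> kk il; right; exists k => //; apply/axis_vectorsP; exists i, false.
  by rewrite expr0 mul1r.
have paxis k i : k \in ks -> (i < l.+1)%N -> pos_image Rp f (k *: E i).
  move=> kk il; have Mk := Maxis k i kk il.
  case: (kP kk) => [->|[k2 t1]]; first exact: faxis.
  have e : k *: E i = t *: E i + t *: E i :> 'rV[K]_l.+1.
    by rewrite k2 t1 scale1r scaler_nat mulr2n.
  by rewrite e in Mk *; apply: (pos_imageD hP finj fM) => //; apply: faxis.
have neg b x : b \in Rp -> f b = - x -> pos_image Rp f x -> nat_comb a f (f b).
  by move=> bp e px; case: (pos_imageN hP finj px); exists b.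
have sumcase b i j (s u : bool) : b \in Rp -> (i < j)%N -> (j < l.+1)%N ->
    f b = (-1) ^+ s *: E i + (-1) ^+ u *: E j -> nat_comb a f (f b).
  move=> bp ij jl; case: s; case: u; rewrite ?(expr0, expr1, scale1r, scaleN1r) => e.
  - by apply: (neg _ _ bp _ (psum i j ij jl)); rewrite opprD.
  - by apply: (neg _ _ bp _ (fdiff i j ij jl)); rewrite opprB addrC.
  - by rewrite e; apply: diff.
  by rewrite e; apply: sum.
exists a, f; split=> //.
- apply: (model_base finj _ ap (d := last_scale t)) => // [i|b bp].
    by rewrite /last_scale; case: ifP => // _; apply: oner_neq0.
  have : M (f b) by apply: (root_image fM); apply: (root_of_pos hP).
  case=> [/sums_and_differencesP [i [j [s [u [il jl ij e]]]]]|[k kk]].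
    move: ij; rewrite neq_ltn => /orP [] ij; first exact: sumcase e.
    by rewrite addrC in e; apply: sumcase e.
  move=> /axis_vectorsP [i [s [il e]]].
  case: s e; rewrite ?(expr0, expr1, mul1r, mulN1r) => e.
    by apply: (neg _ _ bp _ (paxis k i kk il)); rewrite e scaleNr.
  by rewrite e; case: (kP kk) => [->|[-> _]]; [apply: axis | apply: axis2].
- move=> c cd; apply: (model_frame hR hP finj fM) => // i x.
  exact: signed_roots_refl.
- move=> i /(root_image fM); rewrite linearZ /= fa => h.
  have il : (i < l.+1)%N by [].
  have dge : 1 <= last_scale t i.
    by rewrite /last_scale; case: ifP => // _; case: t12 => ->; rewrite ?lexx ?ler1n.
  have [|k kk] := signed_roots_large (i := i) h.
    rewrite !entryZ entryB !entry_unit il eqxx (ltn_eqF (ltnSn i)) /= subr0 mulr1.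
    by lra.
  (* Before the last index the doubled root also has a nonzero coordinate at [i.+1], so it is no
     axis vector. *)
  have [il'|li] := ltnP i l.
    move=> /(congr1 (X i.+1)); rewrite !entryZ entryB !entry_unit !eqxx.
    rewrite (gtn_eqF (ltnSn i)) (il' : i.+1 < l.+1)%N /= sub0r mulr0 => e.
    move/eqP: e; rewrite !mulf_eq0 pnatr_eq0 oppr_eq0 oner_eq0 orbF /= => /eqP e.
    by rewrite e ler10 in dge.
  have iE : i = ord_max by apply/val_inj/eqP; rewrite eqn_leq li -ltnS ltn_ord.
  rewrite iE /last_scale ltnn lastE => /(congr1 (X l)).
  rewrite !entryZ !entry_unit eqxx ltnSn /= !mulr1 => e.
  by rewrite e.
move=> k2; apply: (image_root finj fM); rewrite linearZ /= flast scalerA.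
exact: Maxis.
Qed.

End Signed.

Lemma type_A_quadratic l :
  of_type_A R l -> quadratic form R Rp (weight_lattice form R).
Proof.
move=> /type_A_base [a [f [ha hf no2]]]; apply/(quadraticP hR hP ha).
have fa := frame_base hf.
have hf' : frame form a (fun i => 1%N%:R) (fun=> 1) f by [].
have hc : multipliers form R a (fun=> 1%N).
  apply: (frame_multipliers fa hf') => [i|i|i]; first by left.
    by rewrite (negPf (no2 i)).
  exact: (is_integer_nat K 1).
exists (fun=> 1%N); split=> //.
  by rewrite (weight_lattice_scaled hR hP ha hc).
by apply: (frame_height fa hf') => // i; rewrite oner_neq0.
Qed.

Lemma type_A1_quadratic :
  of_type_A R 1 -> quadratic form R Rp (root_lattice R).
Proof.
move=> /type_A_base [a [f [ha hf no2]]]; apply/(quadraticP hR hP ha).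
have self i j : pairing (a i) (a j) / 2%:R = 1.
  by rewrite !ord1 pairing_self ?(base_neq0 hR hP ha) // divff // pnatr_eq0.
have hc : multipliers form R a (fun=> 2%N).
  split=> // [i|i j]; first by right.
  by rewrite self; apply: (is_integer_nat K 1).
exists (fun=> 2%N); split=> //.
  by rewrite (rank1_root_lattice hR hP ha hc).
by move=> j; rewrite /height big_ord1 self.
Qed.

(** The coroot of the unit vector is twice its coordinate, hence even on the integral vectors; the
    multiplier 2 at the last vertex accounts for this. *)
Definition short_last l (i : 'I_l.+1) : nat := if (i < l)%N then 1%N else 2%N.

Lemma last_scale_ge0 l (t : K) (i : 'I_l.+1) : 0 <= t -> 0 <= last_scale t i.
Proof. by rewrite /last_scale; case: ifP. Qed.

Lemma type_C_quadratic l :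
  of_type_C R l.+1 -> quadratic form R Rp (weight_lattice form R).
Proof.
rewrite /of_type_C rootsC_signed => iso.
have [|||a [f [ha fM hf h2 _]]] := @signed_base l 2 [:: 2] _ _ _ iso.
- by right.
- by rewrite inE.
- by move=> k; rewrite inE => /eqP ->; left.
have no2 i : 2 *: a i \notin R.
  apply/negP => /h2 [_]; rewrite inE => /eqP h; exfalso; move: h; lra.
apply/(quadraticP hR hP ha).
have hf' : frame form a (fun i => 1%N%:R) (last_scale 2) f.
  by apply: hf => i; rewrite mul1r.
have fa := frame_base hf'.
have hc : multipliers form R a (fun=> 1%N).
  apply: (frame_multipliers fa hf') => [i|i|i]; first by left.
    by rewrite (negPf (no2 i)).
  rewrite /last_scale; case: ifP => _.
    exact: (is_integer_nat K 1).
  exact: (is_integer_nat K 2).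
exists (fun=> 1%N); split=> //.
  by rewrite (weight_lattice_scaled hR hP ha hc).
apply: (frame_height fa hf') => i; first by rewrite oner_neq0.
by apply: last_scale_ge0; rewrite ler0n.
Qed.

Lemma short_frame l (ks : seq K) : 1 \in ks ->
  (forall k, k \in ks -> k = 1 \/ k = 2) ->
  isomorphic_to R (@signed_roots K l.+1 ks) ->
  exists (a : 'I_l.+1 -> V) (f : 'Hom(V, 'rV[K]_l.+1)),
  [/\ is_base Rp a, [set f v | v in [set` R]]%classic = @signed_roots K l.+1 ks,
      frame form a (fun i => (short_last i)%:R) (last_scale 1) f,
      multipliers form R a (@short_last l)
    & (forall j, 0 <= height form a (@short_last l) (a j)) /\
      (2 \in ks -> 2 *: a ord_max \in R)].
Proof.
move=> k1 k12 iso.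
have [||a [f [ha fM hf h2 h2']]] := @signed_base l 1 ks _ k1 _ iso.
- by left.
- by move=> k /k12 [] ->; [left | right].
have hf' : frame form a (fun i => (short_last i)%:R) (last_scale 1) f.
  by apply: hf => i; rewrite /short_last /last_scale ltnS; case: ifP; rewrite mulr1.
have fa := frame_base hf'.
exists a, f; split=> //.
- apply: (frame_multipliers fa hf') => [i|i|i].
  + by rewrite /short_last; case: ifP; [left | right].
  + by move=> /h2 [-> _]; rewrite /short_last ltnn.
  by rewrite /last_scale if_same; apply: (is_integer_nat K 1).
split; last by rewrite -[X in X \in ks -> _]mulr1.
apply: (frame_height fa hf') => i; last by apply: last_scale_ge0.
by rewrite /short_last; case: ifP; rewrite pnatr_eq0.
Qed.

Lemma type_B_quadratic l :
  of_type_B R l.+1 -> quadratic form R Rp (root_lattice R).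
Proof.
rewrite /of_type_B rootsB_signed => iso.
have [||a [f [ha fM hf hc [hh _]]]] := short_frame _ _ iso.
- by rewrite inE.
- by move=> k; rewrite inE => /eqP ->; left.
apply/(quadraticP hR hP ha); exists (@short_last l); split=> //.
apply/esym/(frame_root_lattice hR hP ha hc hf); rewrite fM => x h; right.
by exists 1; rewrite ?inE.
Qed.

Lemma type_BC_quadratic l :
  of_type_BC R l.+1 -> quadratic form R Rp (weight_lattice form R).
Proof.
rewrite /of_type_BC rootsBC_signed => iso.
have [||a [f [ha fM hf hc [hh h2]]]] := short_frame _ _ iso.
- by rewrite !inE eqxx.
- by move=> k; rewrite !inE => /orP [] /eqP ->; [left | right].
apply/(quadraticP hR hP ha); exists (@short_last l); split=> //.
rewrite (weight_lattice_scaled hR hP ha hc) // => i.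
rewrite /short_last; case: ltnP => // li _.
have -> : i = ord_max by apply/val_inj/eqP; rewrite eqn_leq li -ltnS ltn_ord.
by apply: h2; rewrite !inE eqxx orbT.
Qed.

End Converse.

Theorem proposition5 (K : realFieldType) (V : vectType K)
  (form : {dot V for idfun}) (R Rp : {fset V}) (L : set V) :
  root_system form R ->
  irreducible_roots form R ->
  positive_roots R Rp ->
  let P := weight_lattice form R in
  let Q := root_lattice R in
  quadratic form R Rp L <->
  [\/ of_type_A R 1 /\ (L = P \/ L = Q),
      of_type_BC R 1 /\ L = P,
      exists l : nat, [/\ (2 <= l)%N,
        [\/ of_type_A R l, of_type_C R l | of_type_BC R l] & L = P]
    | exists l : nat, [/\ (2 <= l)%N, of_type_B R l & L = Q]].
Proof.
move=> hR hirr hP P Q; split; first exact: quadratic_types.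
case=> [[A1 [] ->]|[BC1 ->]|[[|[|l]] [//= _ T ->]]|[[|[|l]] [//= _ B ->]]].
- exact: type_A_quadratic A1.
- exact: type_A1_quadratic.
- exact: type_BC_quadratic BC1.
- case: T => T; [exact: type_A_quadratic T | exact: type_C_quadratic T |].
  exact: type_BC_quadratic T.
exact: type_B_quadratic B.
Qed.
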